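(* Let $S_{m,n}$ be subsampled randomized Hadamard transform (SRHT) sketching matrices and $\gamma_n=m/n$. Let $(a_n)$, $(\tilde a_n)$ be sequences of deterministic unit vectors, $a_n,\tilde a_n\in\mathbb R^n$, satisfying the condition $$(\mathfrak P):\qquad\|a_n\|_\infty\to0\quad\text{or}\quad\|\tilde a_n\|_\infty\to0.$$ If $m/\log^2n\to\infty$ and $\limsup m/n<1$, as $m,n\to\infty$, then $$\sqrt{\frac m{1-\gamma_n}}\sqrt{\frac1{1+2(a_n^\top\tilde a_n)^2}}\;\big(a_n^\top S_{m,n}^\top S_{m,n}\tilde a_n-a_n^\top\tilde a_n\big)\Rightarrow\mathcal N(0,1).$$ Moreover, if $(\mathfrak P)$ fails, $\sqrt m\,a_n^\top S_{m,n}^\top S_{m,n}\tilde a_n$ need not be asymptotically normal even if $m/n$ converges: there exist sequences of unit vectors $(a_n),(\tilde a_n)$ not satisfying $(\mathfrak P)$, and a choice of $m=m_n$ with $m/n$ convergent, for which there are no real sequences $\mu_n$ and $s_n>0$ with $s_n^{-1}(\sqrt m\,a_n^\top S_{m,n}^\top S_{m,n}\tilde a_n-\mu_n)\Rightarrow\mathcal N(0,1)$.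
   Context: $n=2^l$ ranges over powers of two, $m=m_n<n$. Hadamard matrices: $H_0=1$, $H_{t+1}=\frac1{\sqrt2}\begin{pmatrix}H_t&H_t\\H_t&-H_t\end{pmatrix}$. The SRHT sketching matrix is $S_{m,n}=\sqrt{n/m}\,BH_lD$, where $B$ is an $n\times n$ diagonal matrix with i.i.d. Bernoulli$(m/n)$ diagonal entries and $D$ is an independent $n\times n$ diagonal matrix with i.i.d. Rademacher ($\pm1$ with probability $1/2$) diagonal entries. *)

(* Defs.v *)
From HB Require Import structures.
From mathcomp Require Import all_boot all_order all_algebra.
From mathcomp Require Import all_classical all_reals all_analysis.

Set Implicit Arguments.
Unset Strict Implicit.
Unset Printing Implicit Defensive.

Import Order.TTheory GRing.Theory Num.Theory.
Import numFieldNormedType.Exports.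

Local Open Scope classical_set_scope.
Local Open Scope ring_scope.

Definition norm2 (R : realType) (n : nat) (v : 'cV[R]_n) : R :=
  Num.sqrt (\sum_i v i 0 ^+ 2).

(* On column vectors `mx_norm` is the maximum of the absolute values of the
   entries, that is, the sup norm. *)
Definition normoo (R : realType) (n : nat) (v : 'cV[R]_n) : R := mx_norm v.

Lemma hadamard_dimE (t : nat) : (2 ^ t + 2 ^ t)%N = (2 ^ t.+1)%N.
Proof. by rewrite expnS mul2n addnn. Qed.

Fixpoint hadamard (R : realType) (t : nat) : 'M[R]_(2 ^ t) :=
  match t return 'M[R]_(2 ^ t) with
  | 0 => 1%:M
  | t'.+1 => castmx (hadamard_dimE t', hadamard_dimE t')
      ((Num.sqrt 2)^-1 *: block_mx (hadamard R t') (hadamard R t')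
                                   (hadamard R t') (- hadamard R t'))
  end.

(* `b` and `e` are the diagonals of the matrices B and D.  When m = 0 the
   convention n / 0 = 0 makes this the null matrix. *)
Definition srht (R : realType) (l m : nat) (b e : 'I_(2 ^ l) -> R)
    : 'M[R]_(2 ^ l) :=
  Num.sqrt ((2 ^ l)%:R / m%:R) *:
    (diag_mx (\row_i b i) *m hadamard R l *m diag_mx (\row_i e i)).

Definition dotv (R : realType) (n : nat) (u v : 'cV[R]_n) : R :=
  (u^T *m v) 0 0.

Definition sketched_dotv (R : realType) (n : nat) (S : 'M[R]_n)
    (u v : 'cV[R]_n) : R :=
  (u^T *m S^T *m S *m v) 0 0.

Section random_entries.
Context d (T : measurableType d) (R : realType) (P : probability T R).

Definition mutually_independent (I : finType) (X : I -> {RV P >-> R}) : Prop :=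
  forall (J : {set I}) (A : I -> set R), (forall i, measurable (A i)) ->
    P (\bigcap_(i in [set` J]) X i @^-1` A i) =
    (\prod_(i in J) P (X i @^-1` A i))%E.

Definition has_bernoulli_law (p : R) (X : {RV P >-> R}) : Prop :=
  P (X @^-1` [set 1]) = p%:E /\ P (X @^-1` [set 0]) = (1 - p)%:E.

Definition has_rademacher_law (X : {RV P >-> R}) : Prop :=
  P (X @^-1` [set 1]) = (2^-1)%:E /\ P (X @^-1` [set -1]) = (2^-1)%:E.

(* Independence of the two random diagonals and of the entries of each of them
   amounts to mutual independence of the 2n entries taken together. *)
Definition srht_entries (n m : nat) (B D : 'I_n -> {RV P >-> R}) : Prop :=
  [/\ mutually_independent
        (fun k : 'I_n + 'I_n => match k with inl i => B i | inr i => D i end),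
      forall i, has_bernoulli_law (m%:R / n%:R) (B i) &
      forall i, has_rademacher_law (D i)].

End random_entries.

(* Weak convergence of the laws of real random variables X l, possibly defined
   on different probability spaces, to a probability measure on the line.  The
   X l are plain functions: this is meaningful only when they are measurable,
   which is the case for polynomial expressions in random variables. *)
Definition cvg_in_law (R : realType) (d : nat -> measure_display)
    (T : forall l, measurableType (d l)) (P : forall l, probability (T l) R)
    (X : forall l, T l -> R) (mu : probability (measurableTypeR R) R) : Prop :=
  forall f : R -> R, continuous f -> (exists M : R, forall x, `|f x| <= M) ->
    ('E_(P l)[fun w => f (X l w)])%E @[l --> \oo] --> (\int[mu]_x (f x)%:E)%E.

(* The first condition forces m 0 = 0, which is harmless since everything is
   asymptotic in l; the second one makes m l positive for l large. *)
Definition sketch_regime (R : realType) (m : nat -> nat) : Prop :=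
  [/\ forall l, (m l < 2 ^ l)%N,
      ((m l)%:R / ln (2 ^ l)%:R ^+ 2 : R) @[l --> \oo] --> +oo &
      (limn_esup (fun l => ((m l)%:R / (2 ^ l)%:R : R)%:E) < 1)%E].

Definition condP (R : realType) (a a' : forall l, 'cV[R]_(2 ^ l)) : Prop :=
  (normoo (a l) @[l --> \oo] --> 0) \/ (normoo (a' l) @[l --> \oo] --> 0).

(* Main.v *)
Require Import Defs.
From HB Require Import structures.
From mathcomp Require Import all_boot all_order all_algebra.
From mathcomp Require Import all_classical all_reals all_analysis.
From mathcomp Require Import measurable_realfun.
From mathcomp Require Import ring lra zify.

Import Order.TTheory GRing.Theory Num.Theory.
Import numFieldNormedType.Exports.

Local Open Scope classical_set_scope.
Local Open Scope ring_scope.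

(** Let [h] be the Hadamard matrix rescaled to entries of absolute value one,
    [n = 2 ^ l] its size, [x i] and [y i] the coordinates of [h D a] and
    [h D a'], and [rho] the inner product of [a] and [a'].  The sketched inner
    product is the sum of [(b i) ^ 2 * x i * y i] over [i], divided by [m], and
    by Parseval [rho] is the average of [x i * y i]; so the centered statistic
    is, up to a scalar, the sum of [(b i - m / n) * x i * y i].  Given the
    signs [D], this is a sum of independent centered variables, which is nearly
    normal once its conditional variance is nearly deterministic and its
    fourth order Lyapunov ratio is small.

    The conditional variance is proportional to the average of
    [x i ^ 2 * y i ^ 2], a polynomial of degree four in the signs
    ([sketch_fourth_split]).  Its monomials in which the indices agree in pairs
    add up to [1 + 2 * rho ^ 2], up to [2 * \sum_j a j ^ 2 * a' j ^ 2]; the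
    others are orthogonal unless they use the same indices, and the second
    moment of their sum is bounded through Parseval by a constant times the
    square of the sup norm of either vector ([rade_sketch_fourth]).  This is
    where the delocalization of one of the two vectors enters.  The Lyapunov
    ratio is at most [105 / (m * (1 - m / n))], through the eighth moments of
    the [x i] and [y i] ([rade_even_moments], [rade_fourth_power]).

    Normality itself comes from Stein's method.  For a bounded continuous [phi]
    with Gaussian mean [c], the equation [f' x - x * f x = phi x - c] has a
    bounded solution, and cutting it off gives a test function with compact
    support ([stein_test_function]).  For a sum [Z] of centered Bernoulli
    variables the mean of [Z * f Z] is exactly a combination of the means of
    increments of [f], hence close to the mean of [f' Z] ([stein_bern]).  All
    expectations are finite sums over bits, because the entries of [B] and [D]
    take two values each ([expectation_srht]).

    For the last claim take [a] and [a'] proportional to [e_0 + e_1] and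
    [e_0 - e_1].  Then [x i * y i] is half of a difference of two squares equal
    to one, so the sketched inner product vanishes almost surely, and a constant
    has no normal limit under any affine normalization. *)

Set Implicit Arguments.
Unset Strict Implicit.
Unset Printing Implicit Defensive.

(** * Averages over independent bits *)

Section bernoulli_average.
Context {R : realType} {I : finType}.
Implicit Types (p : R) (F G : {ffun I -> bool} -> R) (b : {ffun I -> bool}).

Definition bern_weight p b : R := \prod_i (if b i then p else 1 - p).

(** The mean of [F] at independent bits which are [true] with probability [p];
    for [p = 2^-1] the bits encode signs through [bool_sign]. *)
Definition bern p F : R := \sum_b bern_weight p b * F b.

Definition set_bit b (i : I) (c : bool) : {ffun I -> bool} :=
  [ffun j => if j == i then c else b j].

Lemma eq_bern p F G : F =1 G -> bern p F = bern p G.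
Proof. by move=> FG; apply: eq_bigr => b _; rewrite FG. Qed.

Lemma bernD p F G : bern p (fun b => F b + G b) = bern p F + bern p G.
Proof. by rewrite -big_split; apply: eq_bigr => b _; rewrite mulrDr. Qed.

Lemma bernZ p (c : R) F : bern p (fun b => c * F b) = c * bern p F.
Proof. by rewrite /bern mulr_sumr; apply: eq_bigr => b _; rewrite mulrCA. Qed.

Lemma bernN p F : bern p (fun b => - F b) = - bern p F.
Proof. by rewrite -mulN1r -bernZ; apply: eq_bern => b; rewrite mulN1r. Qed.

Lemma bernB p F G : bern p (fun b => F b - G b) = bern p F - bern p G.
Proof. by rewrite bernD bernN. Qed.

Lemma bern_sum p (J : finType) (Q : pred J) (F : J -> {ffun I -> bool} -> R) :
  bern p (fun b => \sum_(j | Q j) F j b) = \sum_(j | Q j) bern p (F j).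
Proof.
rewrite /bern exchange_big; apply: eq_bigr => b _.
by rewrite mulr_sumr.
Qed.

Lemma bern_weight_sum p : \sum_b bern_weight p b = 1.
Proof.
rewrite /bern_weight.
rewrite -(bigA_distr_bigA (fun (_ : I) (c : bool) => if c then p else 1 - p)).
by rewrite big1 // => i _; rewrite big_bool /= addrC subrK.
Qed.

Lemma bern_cst p (c : R) : bern p (fun=> c) = c.
Proof. by rewrite /bern -mulr_suml bern_weight_sum mul1r. Qed.

Lemma bern_weight_ge0 p b : 0 <= p <= 1 -> 0 <= bern_weight p b.
Proof.
by move=> /andP[p0 p1]; apply: prodr_ge0 => i _; case: ifP; rewrite ?subr_ge0.
Qed.

Lemma bern_le p F G : 0 <= p <= 1 -> (forall b, F b <= G b) ->
  bern p F <= bern p G.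
Proof.
by move=> p01 FG; apply: ler_sum => b _; rewrite ler_wpM2l ?bern_weight_ge0.
Qed.

Lemma ler_norm_bern p F : 0 <= p <= 1 ->
  `|bern p F| <= bern p (fun b => `|F b|).
Proof.
move=> p01; apply: le_trans (ler_norm_sum _ _ _) _.
by apply: ler_sum => b _; rewrite normrM ger0_norm ?bern_weight_ge0.
Qed.

(** The bit [b i] and an independent copy [c] of it have the same joint law
    after they are exchanged. *)
Lemma bern_resample p i F :
  bern p F = bern p (fun b => p * F (set_bit b i true) +
                              (1 - p) * F (set_bit b i false)).
Proof.
pose w (c : bool) := if c then p else 1 - p.
pose swap (bc : {ffun I -> bool} * bool) := (set_bit bc.1 i bc.2, bc.1 i).
have swapK : involutive swap.
  case=> b c; rewrite /swap /=; congr pair; last by rewrite ffunE eqxx.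
  by apply/ffunP => j; rewrite !ffunE; case: eqP => [->|].
have wswap bc : bern_weight p (swap bc).1 * w (swap bc).2 =
                bern_weight p bc.1 * w bc.2.
  case: bc => b c; rewrite /bern_weight /= (bigD1 i) //= [in RHS](bigD1 i) //=.
  rewrite ffunE eqxx (eq_bigr (fun j => if b j then p else 1 - p)).
    by rewrite -/(w c) -/(w (b i)); ring.
  by move=> j ji; rewrite ffunE (negbTE ji).
transitivity (\sum_(bc : {ffun I -> bool} * bool)
    bern_weight p bc.1 * w bc.2 * F bc.1).
  rewrite -(pair_big xpredT xpredT
    (fun b c => bern_weight p b * w c * F b)) /=.
  apply: eq_bigr => b _; rewrite big_bool /= -mulrDl -mulrDr /w.
  by rewrite addrC subrK mulr1.
rewrite (reindex_inj (inv_inj swapK)) /=.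
under eq_bigr => bc _ do rewrite wswap.
rewrite -(pair_big xpredT xpredT
  (fun b c => bern_weight p b * w c * F (set_bit b i c))) /=.
by apply: eq_bigr => b _; rewrite big_bool /= -!mulrA -mulrDr.
Qed.

(** Discrete integration by parts in the bit [i]. *)
Lemma bern_centered_bit p i F :
  bern p (fun b => ((b i)%:R - p) * F b) =
  p * (1 - p) * bern p (fun b => F (set_bit b i true) - F (set_bit b i false)).
Proof.
rewrite (bern_resample _ i) -bernZ; apply: eq_bern => b.
by rewrite !ffunE eqxx /=; ring.
Qed.

End bernoulli_average.

Section rademacher_average.
Context {R : realType} {I : finType}.
Implicit Types (F : {ffun I -> bool} -> R) (e : {ffun I -> bool}).

Local Notation rade := (bern (2^-1 : R)).

Definition bool_sign (c : bool) : R := if c then 1 else -1.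

Lemma half01 : 0 <= (2^-1 : R) <= 1.
Proof. by rewrite invr_ge0 ler0n invf_le1 ?ler1n ?ltr0n. Qed.

Lemma bool_sign_sqr c : bool_sign c ^+ 2 = 1.
Proof. by case: c; rewrite /= ?sqrrN expr1n. Qed.

Lemma bool_sign_norm c : `|bool_sign c| = 1.
Proof. by case: c; rewrite /= ?normrN normr1. Qed.

Lemma rade_resample i F :
  rade F = rade (fun e => 2^-1 * (F (set_bit e i true) + F (set_bit e i false))).
Proof. by rewrite (bern_resample _ i); apply: eq_bern => e; field. Qed.

Lemma rade_odd i F :
  (forall e, F (set_bit e i false) = - F (set_bit e i true)) -> rade F = 0.
Proof.
move=> oddF; rewrite (rade_resample i) -[RHS](@bern_cst R I 2^-1).
by apply: eq_bern => e; rewrite oddF subrr mulr0.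
Qed.

Definition sign_prod k (J : {ffun 'I_k -> I}) e : R := \prod_s bool_sign (e (J s)).

Lemma sign_prod_norm k (J : {ffun 'I_k -> I}) e : `|sign_prod J e| = 1.
Proof. by rewrite normr_prod big1 // => s _; rewrite bool_sign_norm. Qed.

(** Flipping the bit of index [J s] changes the sign of the product. *)
Lemma rade_sign_prod2 k (J J' : {ffun 'I_k -> I}) s :
  injectiveb J -> J s \notin codom J' ->
  rade (fun e => sign_prod J e * sign_prod J' e) = 0.
Proof.
move=> /injectiveP Jinj JsJ'; apply: (@rade_odd (J s)) => e.
rewrite -mulNr; congr (_ * _).
  rewrite /sign_prod (bigD1 s) //= [in RHS](bigD1 s) //= -mulNr !ffunE eqxx.
  congr (_ * _); apply: eq_bigr => t ts; rewrite !ffunE.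
  by rewrite (inj_eq Jinj) (negbTE ts).
apply: eq_bigr => t _; rewrite !ffunE.
by case: eqP => // J't; move: JsJ'; rewrite -J't codom_f.
Qed.

(** Two monomials on distinct indices are orthogonal unless they use the same
    indices, and each index set is used by at most [k ^ k] of them. *)
Lemma rade_chaos_sqr k (beta : {ffun 'I_k -> I} -> R) :
  (forall J : {ffun 'I_k -> I}, ~~ injectiveb J -> beta J = 0) ->
  rade (fun e => (\sum_J beta J * sign_prod J e) ^+ 2) <=
  (k ^ k)%:R * \sum_J beta J ^+ 2.
Proof.
move=> beta0.
pose near_idx (J J' : {ffun 'I_k -> I}) := [forall s, J s \in codom J'].
have term J J' : beta J * beta J' * rade (fun e => sign_prod J e * sign_prod J' e)
   <= 2^-1 * ((near_idx J' J)%:R * beta J ^+ 2 + (near_idx J J')%:R * beta J' ^+ 2).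
  have rhs0 : 0 <= 2^-1 *
     ((near_idx J' J)%:R * beta J ^+ 2 + (near_idx J J')%:R * beta J' ^+ 2).
    by rewrite mulr_ge0 ?invr_ge0 ?ler0n // addr_ge0 // mulr_ge0 ?ler0n ?sqr_ge0.
  have [Jinj|/beta0 bJ0] := boolP (injectiveb J); last first.
    by rewrite {1}bJ0 2!mul0r.
  have [J'inj|/beta0 bJ0] := boolP (injectiveb J'); last first.
    by rewrite {1}bJ0 mulr0 mul0r.
  case: (boolP (near_idx J J')) rhs0 => [JJ'|/forallPn[s sJ']] rhs0; last first.
    by rewrite (rade_sign_prod2 Jinj sJ') mulr0.
  case: (boolP (near_idx J' J)) rhs0 => [J'J|/forallPn[s sJ']] rhs0; last first.
    under eq_bern => e do rewrite mulrC.
    by rewrite (rade_sign_prod2 J'inj sJ') mulr0.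
  apply: (@le_trans _ _ `|beta J * beta J'|).
    apply: le_trans (ler_norm _) _; rewrite normrM ler_piMr //.
    apply: le_trans (ler_norm_bern _ half01) _.
    rewrite -[leRHS](@bern_cst R I 2^-1); apply: bern_le half01 _ => e.
    by rewrite normrM !sign_prod_norm mulr1.
  rewrite !mul1r normrM -[beta J ^+ 2]real_normK ?num_real //.
  rewrite -[beta J' ^+ 2]real_normK ?num_real //.
  have := sqr_ge0 (`|beta J| - `|beta J'|); rewrite sqrrB; lra.
have count (J : {ffun 'I_k -> I}) : \sum_J' (near_idx J' J)%:R <= (k ^ k)%:R :> R.
  rewrite -natr_sum ler_nat -big_mkcond /= sum1_card.
  rewrite (@eq_card _ _ (ffun_on (mem (@codom _ I J)))); last first.
    by move=> J'; apply/forallP/ffun_onP.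
  rewrite card_ffun_on card_ord.
  have : (#|codom J| <= k)%N by rewrite -[leqRHS]card_ord -(size_codom J) card_size.
  move: #|_| => N Nk; have [k0|k0] := posnP k; last by rewrite leq_exp2r.
  by rewrite k0 !expn0.
rewrite (@eq_bern _ _ _ _ (fun e => \sum_J \sum_J' beta J * beta J' *
   (sign_prod J e * sign_prod J' e))); last first.
  move=> e; rewrite expr2 big_distrlr; apply: eq_bigr => J _.
  by apply: eq_bigr => J' _; rewrite mulrACA.
rewrite bern_sum; under eq_bigr => J _.
  rewrite bern_sum; under eq_bigr => J' _ do rewrite bernZ.
  over.
apply: (@le_trans _ _ (\sum_J \sum_J' 2^-1 *
   ((near_idx J' J)%:R * beta J ^+ 2 + (near_idx J J')%:R * beta J' ^+ 2))).
  by apply: ler_sum => J _; apply: ler_sum => J' _; exact: term.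
under eq_bigr => J _ do rewrite -mulr_sumr big_split.
rewrite -mulr_sumr big_split /= [X in _ + X]exchange_big /= -mulr2n.
rewrite -[X in _ * X]mulr_natl mulrA mulVf ?pnatr_eq0 // mul1r.
rewrite mulr_sumr; apply: ler_sum => J _.
by rewrite -mulr_suml ler_wpM2r ?sqr_ge0.
Qed.

Definition sign_sum (r : seq I) (alpha : I -> R) e : R :=
  \sum_(j <- r) bool_sign (e j) * alpha j.

(** Averaging over the sign of a new term leaves only its even powers, so the
    moments are bounded by induction; the constants are the Gaussian moments. *)
Lemma rade_even_moments (alpha : I -> R) (r : seq I)
    (v : R := \sum_(j <- r) alpha j ^+ 2) (S := sign_sum r alpha) : uniq r ->
  [/\ rade (fun e => S e ^+ 2) = v, rade (fun e => S e ^+ 4) <= 3 * v ^+ 2,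
      rade (fun e => S e ^+ 6) <= 15 * v ^+ 3 &
      rade (fun e => S e ^+ 8) <= 105 * v ^+ 4].
Proof.
rewrite {}/v {}/S; elim: r => [|j r IHr] /=.
  by split; under eq_bern do rewrite /sign_sum big_nil expr0n;
     rewrite bern_cst big_nil ?expr0n ?mulr0.
case/andP => jr /IHr; rewrite big_cons.
set v := \sum_(_ <- _) _; set S := sign_sum r alpha.
have v0 : 0 <= v by apply: sumr_ge0 => ? _; rewrite sqr_ge0.
have Sj e c : S (set_bit e j c) = S e.
  apply: eq_big_seq => k kr; rewrite ffunE; case: eqP => // kj.
  by rewrite kj (negbTE jr) in kr.
set a := alpha j; set w := a ^+ 2; have w0 : 0 <= w by rewrite sqr_ge0.
have split_j k : rade (fun e => sign_sum (j :: r) alpha e ^+ k) =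
    rade (fun e => 2^-1 * ((a + S e) ^+ k + (- a + S e) ^+ k)).
  rewrite (rade_resample j); apply: eq_bern => e; rewrite /sign_sum !big_cons.
  by rewrite -!/(sign_sum r alpha _) -/S !Sj !ffunE !eqxx /= mul1r mulN1r.
have vw : 0 <= v * w by rewrite mulr_ge0.
have vvw : 0 <= v ^+ 2 * w by apply: mulr_ge0 => //; exact: exprn_ge0.
have vww : 0 <= v * w ^+ 2 by apply: mulr_ge0 => //; exact: exprn_ge0.
have vvvw : 0 <= v ^+ 3 * w by apply: mulr_ge0 => //; exact: exprn_ge0.
have vvww : 0 <= v ^+ 2 * w ^+ 2 by apply: mulr_ge0; exact: exprn_ge0.
have vwww : 0 <= v * w ^+ 3 by apply: mulr_ge0 => //; exact: exprn_ge0.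
have ww := exprn_ge0 2 w0; have www := exprn_ge0 3 w0; have wwww := exprn_ge0 4 w0.
case=> m2 m4 m6 m8; split; rewrite split_j.
- rewrite (@eq_bern _ _ _ _ (fun e => S e ^+ 2 + w)); last by move=> e; rewrite /w; field.
  by rewrite bernD bern_cst m2 addrC.
- rewrite (@eq_bern _ _ _ _ (fun e => S e ^+ 4 + (6 * w * S e ^+ 2 + w ^+ 2))); last first.
    by move=> e; rewrite /w; field.
  rewrite !bernD bern_cst !bernZ m2.
  by apply: le_trans (lerD m4 (lexx _)) _; lra.
- rewrite (@eq_bern _ _ _ _ (fun e => S e ^+ 6 + (15 * w * S e ^+ 4 +
    (15 * w ^+ 2 * S e ^+ 2 + w ^+ 3)))); last by move=> e; rewrite /w; field.
  rewrite !bernD bern_cst !bernZ m2.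
  have := ler_wpM2l (mulr_ge0 (ler0n R 15) w0) m4.
  by move=> m4'; apply: le_trans (lerD m6 (lerD m4' (lexx _))) _; lra.
- rewrite (@eq_bern _ _ _ _ (fun e => S e ^+ 8 + (28 * w * S e ^+ 6 +
    (70 * w ^+ 2 * S e ^+ 4 + (28 * w ^+ 3 * S e ^+ 2 + w ^+ 4))))); last first.
    by move=> e; rewrite /w; field.
  rewrite !bernD bern_cst !bernZ m2.
  have := ler_wpM2l (mulr_ge0 (ler0n R 28) w0) m6.
  have := ler_wpM2l (mulr_ge0 (ler0n R 70) ww) m4.
  by move=> m4' m6'; apply: le_trans (lerD m8 (lerD m6' (lerD m4' (lexx _)))) _; lra.
Qed.

End rademacher_average.

(** * Stein's method for sums of centered Bernoulli variables *)

(** The derivative may be taken at an end point: in [stein_bern] it is taken at the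
    actual value of the sum, which is one of the two values that bit [i] allows. *)
Lemma mvt_quadratic_error {R : realType} (f f' : R -> R) (eps C x y z : R) :
  (forall t : R, is_derive t 1 f (f' t)) ->
  (forall t u, `|f' t - f' u| <= eps + C * (t - u) ^+ 2) ->
  0 <= C -> z = x \/ z = y ->
  `|(y - x) * f' z - (f y - f x)| <= `|y - x| * (eps + C * (y - x) ^+ 2).
Proof.
move=> df mod_f' C0 zxy; wlog xy : x y zxy / x <= y => [hw|].
  have /orP[xy|yx] := le_total x y; first exact: hw.
  have -> : (y - x) * f' z - (f y - f x) = - ((x - y) * f' z - (f x - f y)) by ring.
  have -> : (y - x) ^+ 2 = (x - y) ^+ 2 by ring.
  by rewrite normrN (distrC y); apply: hw => //; case: zxy; [right|left].
have cf : {within `[x, y], continuous f}.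
  apply: continuous_subspaceT => t.
  by apply: differentiable_continuous; apply/derivable1_diffP; case: (df t).
have [c] := MVT_segment xy (fun t _ => df t) cf.
rewrite in_itv /= => /andP[xc cy] ->; rewrite mulrC -mulrBl normrM mulrC.
rewrite ler_wpM2l //; apply: le_trans (mod_f' _ _) _.
rewrite lerD2l ler_wpM2l //.
by case: zxy => ->; nra.
Qed.

Section stein_identity.
Context {R : realType} {I : finType} (p : R) (s : I -> R).
Hypothesis p01 : 0 <= p <= 1.

Definition centered_sum (b : {ffun I -> bool}) : R :=
  \sum_i s i * ((b i)%:R - p).

Let V : R := p * (1 - p) * \sum_i s i ^+ 2.

Lemma centered_sum_set_bit b i (c c' : bool) :
  centered_sum (set_bit b i c) - centered_sum (set_bit b i c') =
  s i * (c%:R - c'%:R).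
Proof.
rewrite /centered_sum -sumrB (bigD1 i) //= !ffunE eqxx big1 ?addr0; first by ring.
by move=> j ji; rewrite !ffunE (negbTE ji) subrr.
Qed.

Lemma bern_centered_sumM (f : R -> R) :
  bern p (fun b => centered_sum b * f (centered_sum b)) =
  p * (1 - p) * \sum_i s i * bern p (fun b =>
    f (centered_sum (set_bit b i true)) - f (centered_sum (set_bit b i false))).
Proof.
under eq_bern => b.
  rewrite {1}/centered_sum mulr_suml; under eq_bigr => i _ do rewrite -mulrA.
  over.
rewrite bern_sum mulr_sumr; apply: eq_bigr => i _.
by rewrite bernZ (bern_centered_bit p i (f \o centered_sum)) mulrCA.
Qed.

Lemma bern_centered_sum_sqr : bern p (fun b => centered_sum b ^+ 2) = V.
Proof.
rewrite (bern_centered_sumM id); congr (_ * _); apply: eq_bigr => i _.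
under eq_bern do rewrite centered_sum_set_bit subr0 mulr1.
by rewrite bern_cst expr2.
Qed.

(** Replacing one bit moves the sum by [s i], so the mean value theorem turns
    [bern_centered_sumM] into [V] times the average of [f']. *)
Lemma stein_bern (f f' : R -> R) (M eps C : R) :
  (forall t : R, is_derive t 1 f (f' t)) -> (forall t, `|f' t| <= M) ->
  (forall t u, `|f' t - f' u| <= eps + C * (t - u) ^+ 2) -> 0 <= C ->
  `|bern p (fun b => f' (centered_sum b) - centered_sum b * f (centered_sum b))|
  <= M * `|1 - V| + eps * V + C * (p * (1 - p) * \sum_i s i ^+ 4).
Proof.
move=> df f'M mod_f' C0.
have pq0 : 0 <= p * (1 - p) by move: p01 => /andP[? ?]; rewrite mulr_ge0 ?subr_ge0.
have -> : bern p (fun b => f' (centered_sum b) - centered_sum b * f (centered_sum b)) =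
  (1 - V) * bern p (f' \o centered_sum) +
  p * (1 - p) * \sum_i bern p (fun b => s i * (s i * f' (centered_sum b) -
   (f (centered_sum (set_bit b i true)) - f (centered_sum (set_bit b i false))))).
  rewrite bernB bern_centered_sumM.
  under [in RHS]eq_bigr => i _ do
    (rewrite bernZ bernB mulrBr bernZ mulrA -expr2).
  by rewrite sumrB -mulr_suml /V; ring.
apply: le_trans (ler_normD _ _) _; rewrite -addrA; apply: lerD.
  rewrite normrM mulrC ler_wpM2r //; apply: le_trans (ler_norm_bern _ p01) _.
  by rewrite -[leRHS](@bern_cst R I p); apply: bern_le => // b; exact: f'M.
rewrite normrM (ger0_norm pq0) /V mulrCA (mulrCA C) -mulrDr ler_wpM2l //.
apply: le_trans (ler_norm_sum _ _ _) _; rewrite !mulr_sumr -big_split /=.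
apply: ler_sum => i _; apply: le_trans (ler_norm_bern _ p01) _.
rewrite -[leRHS](@bern_cst R I p); apply: bern_le => // b.
have si := centered_sum_set_bit b i true false; rewrite subr0 mulr1 in si.
have bi : centered_sum b = centered_sum (set_bit b i false) \/
          centered_sum b = centered_sum (set_bit b i true).
  have sb : set_bit b i (b i) = b.
    by apply/ffunP => j; rewrite ffunE; case: eqP => [->|].
  by case E: (b i) in sb; [right|left]; rewrite sb.
have := mvt_quadratic_error df mod_f' C0 bi; rewrite si => le_si.
rewrite normrM; apply: le_trans (ler_wpM2l (normr_ge0 _) le_si) _.
rewrite mulrA -expr2 real_normK ?num_real // mulrDr mulrC lerD2l.
by rewrite mulrCA -exprD.
Qed.

End stein_identity.

(** * The fourth order chaos of a Hadamard transform *)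

Section quadruple_sums.
Context {R : realType} {I : finType}.

(** The chaos bound is indexed by functions on ['I_4], the explicit
    computations by four separate indices. *)
Definition quad_ffun (p q j k : I) : {ffun 'I_4 -> I} :=
  [ffun s => tnth [tuple p; q; j; k] s].

Lemma sum_quad_ffun (G : {ffun 'I_4 -> I} -> R) :
  \sum_J G J = \sum_p \sum_q \sum_j \sum_k G (quad_ffun p q j k).
Proof.
pose f (u : (I * I) * (I * I)) := quad_ffun u.1.1 u.1.2 u.2.1 u.2.2.
pose g (J : {ffun 'I_4 -> I}) := ((J (inord 0), J (inord 1)), (J (inord 2), J (inord 3))).
have fK : cancel f g.
  by case=> [[p q] [j k]]; rewrite /g /f !ffunE /tnth /= !inordK.
have gK : cancel g f.
  move=> J; apply/ffunP => s; rewrite ffunE /tnth /= -[in RHS](inord_val s).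
  by case: s => [[|[|[|[|]]]]].
rewrite (reindex f) /=; last by exists g => ? _; [exact: fK|exact: gK].
rewrite -(pair_big xpredT xpredT (fun x y => G (f (x, y)))) /=.
under eq_bigr => x _ do
  rewrite -(pair_big xpredT xpredT (fun j k => G (f (x, (j, k))))) /=.
by rewrite -(pair_big xpredT xpredT
  (fun p q => \sum_j \sum_k G (f ((p, q), (j, k))))).
Qed.

Lemma prod_quad_ffun p q j k (F : 'I_4 -> I -> R) :
  \prod_s F s (quad_ffun p q j k s) =
  F ord0 p * F (inord 1) q * F (inord 2) j * F (inord 3) k.
Proof.
rewrite !big_ord_recl big_ord0 !ffunE mulr1 !mulrA.
do !congr (_ * _); congr F; apply/val_inj; by rewrite /= ?inordK.
Qed.

Lemma injectiveb_quad_ffun p q j k :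
  injectiveb (quad_ffun p q j k) = uniq [:: p; q; j; k].
Proof.
rewrite /injectiveb /dinjectiveb.
rewrite (@eq_map _ _ _ (tnth [tuple p; q; j; k])); last by move=> s; rewrite ffunE.
by rewrite map_tnth_enum.
Qed.

End quadruple_sums.

Section hadamard_chaos.
Context {R : realType} {I : finType} (h : I -> I -> R) (a b : I -> R).
Hypothesis h_sqr : forall i j, h i j ^+ 2 = 1.
Hypothesis h_col : forall j k, \sum_i h i j * h i k = #|I|%:R * (j == k)%:R.
Hypothesis h_row : forall i k, \sum_j h i j * h k j = #|I|%:R * (i == k)%:R.
Hypothesis a_unit : \sum_j a j ^+ 2 = 1.
Hypothesis b_unit : \sum_j b j ^+ 2 = 1.

Local Notation N := (#|I|%:R : R).
Local Notation rade := (bern (2^-1 : R)).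
Local Notation sgn e j := (bool_sign (e j) : R).

Definition sketch_coord (u : I -> R) (i : I) (e : {ffun I -> bool}) : R :=
  sign_sum (index_enum I) (fun j => h i j * u j) e.

Let coef p q j k : R := N^-1 * \sum_i h i p * h i q * h i j * h i k.

Lemma card_gt0_of_unit : 0 < N.
Proof.
rewrite ltr0n lt0n; apply/eqP => I0; move: a_unit; rewrite big1 => [/eqP|j _].
  by rewrite eq_sym oner_eq0.
by have := fintype0 j I0.
Qed.

Let N0 := card_gt0_of_unit.

Lemma coef_swap12 p q j k : coef p q j k = coef q p j k.
Proof. by congr (_ * _); apply: eq_bigr => i _; ring. Qed.

Lemma coef_swap23 p q j k : coef p q j k = coef p j q k.
Proof. by congr (_ * _); apply: eq_bigr => i _; ring. Qed.

Lemma coef_swap34 p q j k : coef p q j k = coef p q k j.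
Proof. by congr (_ * _); apply: eq_bigr => i _; ring. Qed.

Lemma coef_diag p j k : coef p p j k = (j == k)%:R.
Proof.
rewrite /coef (eq_bigr (fun i => h i j * h i k)) ?h_col ?mulKf ?gt_eqF //.
by move=> i _; rewrite -expr2 h_sqr mul1r.
Qed.

(** Parseval: [coef p _ j k] lists the coordinates of a unit vector in an
    orthonormal basis. *)
Lemma sum_coef_sqr p j k : \sum_q coef p q j k ^+ 2 = 1.
Proof.
pose v i := h i p * h i j * h i k.
have v1 i : v i * v i = 1.
  by rewrite -expr2 /v !exprMn !h_sqr !mulr1.
transitivity (N^-1 * (N^-1 * \sum_i \sum_i' v i * v i' * \sum_q h i q * h i' q)).
  have coefE q : coef p q j k = N^-1 * \sum_i v i * h i q.
    by congr (_ * _); apply: eq_bigr => i _; rewrite /v; ring.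
  under [LHS]eq_bigr => q _.
    rewrite coefE exprMn (expr2 (\sum_i _)) big_distrlr expr2 -mulrA /=.
    under eq_bigr => i _ do under eq_bigr => i' _ do rewrite mulrACA.
    over.
  rewrite -!mulr_sumr exchange_big /=; congr (_ * (_ * _)); apply: eq_bigr => i _.
  by rewrite exchange_big /=; apply: eq_bigr => i' _; rewrite mulr_sumr.
under eq_bigr => i _.
  rewrite (bigD1 i) //= h_row eqxx mulr1 v1 mul1r big1 ?addr0.
    over.
  by move=> i' i'i; rewrite h_row eq_sym (negbTE i'i) !mulr0.
by rewrite sumr_const -[X in _ * (_ * X)]mulr_natl mulKf ?mulVf ?gt_eqF.
Qed.

(** By orthogonality, a coefficient with a repeated index vanishes unless the
    indices are equal in pairs. *)
Lemma coef_sign_split (e : I -> bool) p q j k :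
  coef p q j k * (sgn e p * sgn e q * sgn e j * sgn e k) =
  (if uniq [:: p; q; j; k]
   then coef p q j k * (sgn e p * sgn e q * sgn e j * sgn e k) else 0) +
  ((p == q)%:R * (j == k)%:R + (p == j)%:R * (q == k)%:R +
   (p == k)%:R * (q == j)%:R - 2 * (p == q)%:R * (p == j)%:R * (p == k)%:R).
Proof.
have s1 i : sgn e i * sgn e i = 1 by rewrite -expr2 bool_sign_sqr.
have s2 i l : sgn e i * sgn e i * sgn e l * sgn e l = 1 by rewrite s1 mul1r s1.
rewrite /= !inE !negb_or !andbT.
have [<-{q}|pq] := eqVneq p q.
  rewrite coef_diag /= ?eqxx add0r; have [<-{k}|jk] := eqVneq j k.
    by rewrite s2 /=; ring.
  have [pj|pj] := eqVneq p j; last by rewrite /=; ring.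
  by rewrite pj (negbTE jk) /=; ring.
have [<-{j}|pj] := eqVneq p j.
  rewrite coef_swap23 coef_diag /= add0r; have [<-{k}|qk] := eqVneq q k.
    rewrite (_ : _ * _ * _ * _ = sgn e p * sgn e p * sgn e q * sgn e q); last by ring.
    by rewrite s2 (negbTE pq) (eq_sym q) (negbTE pq) /=; ring.
  by rewrite (eq_sym q p) (negbTE pq) /=; ring.
have [<-{k}|pk] := eqVneq p k.
  rewrite coef_swap34 coef_swap23 coef_diag /= add0r; have [<-{j} {pj}|qj] := eqVneq q j.
    rewrite (_ : _ * _ * _ * _ = sgn e p * sgn e p * sgn e q * sgn e q); last by ring.
    by rewrite s2 /=; ring.
  by rewrite /=; ring.
have [<-{j pj}|qj] := eqVneq q j.
  by rewrite coef_swap12 coef_swap23 coef_diag /= (negbTE pk) /=; ring.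
have [<-{k pk}|qk] := eqVneq q k.
  rewrite coef_swap34 coef_swap12 coef_swap23 coef_diag /= (negbTE pj) /=; ring.
have [<-{k pk qk}|jk] := eqVneq j k.
  rewrite coef_swap23 coef_swap12 coef_swap34 coef_swap23 coef_diag (negbTE pq).
  by rewrite /=; ring.
by rewrite /=; ring.
Qed.

Let rho : R := \sum_j a j * b j.

(** The vectors [a, a, b, b] carried by the four positions. *)
Let factor (s : 'I_4) (j : I) : R := if (s < 2)%N then a j else b j.

(** The coefficients of the part of the average on distinct indices. *)
Let beta (J : {ffun 'I_4 -> I}) : R :=
  if injectiveb J then
    N^-1 * (\sum_i \prod_s h i (J s)) * \prod_s factor s (J s) else 0.

Lemma factor_quad_ffun p q j k :
  \prod_s factor s (quad_ffun p q j k s) = a p * a q * b j * b k.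
Proof. by rewrite prod_quad_ffun /factor /= !inordK. Qed.

Lemma beta_quad_ffun p q j k : beta (quad_ffun p q j k) =
  if uniq [:: p; q; j; k] then coef p q j k * (a p * a q * b j * b k) else 0.
Proof.
rewrite /beta injectiveb_quad_ffun factor_quad_ffun; case: ifP => // _.
congr (_ * _ * _); apply: eq_bigr => i _.
by rewrite (prod_quad_ffun p q j k (fun=> h i)).
Qed.

Lemma sum_delta (j : I) (G : I -> R) : \sum_k (j == k)%:R * G k = G j.
Proof.
rewrite (bigD1 j) //= eqxx mul1r big1 ?addr0 // => k kj.
by rewrite eq_sym (negbTE kj) mul0r.
Qed.

(** The three pairings contribute [1], [rho ^ 2] and [rho ^ 2].  A quadruple of
    equal indices belongs to all three and is counted once. *)
Lemma paired_indices_sum :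
  \sum_p \sum_q \sum_j \sum_k ((p == q)%:R * (j == k)%:R + (p == j)%:R * (q == k)%:R +
   (p == k)%:R * (q == j)%:R - 2 * (p == q)%:R * (p == j)%:R * (p == k)%:R) *
   (a p * a q * b j * b k) = 1 + 2 * rho ^+ 2 - 2 * \sum_j a j ^+ 2 * b j ^+ 2.
Proof.
transitivity (\sum_p \sum_q \sum_j ((p == q)%:R * (a p * a q * b j * b j) +
   (p == j)%:R * (a p * a q * b j * b q) + (q == j)%:R * (a p * a q * b j * b p) -
   (p == j)%:R * (2 * (p == q)%:R * (a p * a q * b j * b p)))).
  apply: eq_bigr => p _; apply: eq_bigr => q _; apply: eq_bigr => j _.
  rewrite (eq_bigr (fun k =>
    (j == k)%:R * ((p == q)%:R * (a p * a q * b j * b k)) +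
    (q == k)%:R * ((p == j)%:R * (a p * a q * b j * b k)) +
    (p == k)%:R * ((q == j)%:R * (a p * a q * b j * b k)) -
    (p == k)%:R * (2 * (p == q)%:R * (p == j)%:R * (a p * a q * b j * b k))));
    last by move=> k _; ring.
  by rewrite !big_split sumrN /= !sum_delta; ring.
transitivity (\sum_p \sum_q ((p == q)%:R * (a p * a q) + 2 * a p * b p * (a q * b q)
   - (p == q)%:R * (2 * (a p * a q * b p * b p)))).
  apply: eq_bigr => p _; apply: eq_bigr => q _.
  rewrite !big_split sumrN /= !sum_delta -mulr_sumr.
  under eq_bigr => j _ do rewrite -mulrA -expr2.
  by rewrite -mulr_sumr b_unit; ring.
transitivity (\sum_p (a p ^+ 2 + 2 * rho * (a p * b p) - 2 * (a p ^+ 2 * b p ^+ 2))).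
  apply: eq_bigr => p _; rewrite !big_split sumrN /= !sum_delta -mulr_sumr -/rho.
  by ring.
by rewrite !big_split sumrN /= -!mulr_sumr -/rho a_unit; ring.
Qed.

Lemma sketch_fourth_split e :
  N^-1 * (\sum_i (sketch_coord a i e * sketch_coord b i e) ^+ 2) =
  \sum_J beta J * sign_prod J e +
  (1 + 2 * rho ^+ 2 - 2 * \sum_j a j ^+ 2 * b j ^+ 2).
Proof.
have sign_quad p q j k : sign_prod (quad_ffun p q j k) e =
    sgn e p * sgn e q * sgn e j * sgn e k.
  by rewrite /sign_prod (prod_quad_ffun p q j k (fun=> fun i => sgn e i)).
have coord_sqr i : (sketch_coord a i e * sketch_coord b i e) ^+ 2 =
    \sum_(J : {ffun 'I_4 -> I}) \prod_s (sgn e (J s) * h i (J s) * factor s (J s)).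
  rewrite -(bigA_distr_bigA (fun s j => sgn e j * h i j * factor s j)).
  rewrite !big_ord_recl big_ord0 /factor /= mulr1 exprMn !expr2 -mulrA.
  by congr (_ * (_ * (_ * _))); apply: eq_bigr => j _; rewrite mulrA.
under eq_bigr => i _ do rewrite coord_sqr.
rewrite exchange_big /= mulr_sumr !sum_quad_ffun -paired_indices_sum -big_split.
apply: eq_bigr => p _; rewrite -big_split; apply: eq_bigr => q _.
rewrite -big_split; apply: eq_bigr => j _; rewrite -big_split; apply: eq_bigr => k _ /=.
rewrite beta_quad_ffun sign_quad.
transitivity (coef p q j k * (sgn e p * sgn e q * sgn e j * sgn e k) *
              (a p * a q * b j * b k)).
  rewrite /coef -!mulrA; congr (_ * _); rewrite mulr_suml; apply: eq_bigr => i _.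
  by rewrite !big_split /= factor_quad_ffun -/(sign_prod _ e) sign_quad
     (prod_quad_ffun p q j k (fun=> h i)); ring.
rewrite coef_sign_split mulrDl; congr (_ + _).
by case: ifP => _; rewrite ?mul0r //; ring.
Qed.

(** Once [b k ^ 2] is bounded by [delta ^ 2], Parseval sums the squared
    coefficients over [k]. *)
Lemma beta_sqr_sum_le (delta : R) : (forall j, `|b j| <= delta) ->
  \sum_J beta J ^+ 2 <= delta ^+ 2.
Proof.
move=> b_small; rewrite sum_quad_ffun.
have b2 k : b k ^+ 2 <= delta ^+ 2.
  by rewrite -real_normK ?num_real // lerXn2r ?nnegrE // (le_trans _ (b_small k)).
apply: (@le_trans _ _ (\sum_p \sum_q \sum_j \sum_k
    coef p k q j ^+ 2 * (a p ^+ 2 * a q ^+ 2 * b j ^+ 2 * delta ^+ 2))).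
  apply: ler_sum => p _; apply: ler_sum => q _; apply: ler_sum => j _.
  apply: ler_sum => k _.
  rewrite beta_quad_ffun (coef_swap34 p q j k) (coef_swap23 p q k j).
  case: ifP => _; last first.
    by rewrite expr0n /=; repeat (exact: sqr_ge0 || apply: mulr_ge0).
  rewrite exprMn; apply: ler_wpM2l; first exact: sqr_ge0.
  rewrite !exprMn; apply: ler_wpM2l => //.
  by repeat (exact: sqr_ge0 || apply: mulr_ge0).
under eq_bigr => p _.
  under eq_bigr => q _.
    under eq_bigr => j _ do rewrite -mulr_suml sum_coef_sqr mul1r.
    rewrite -mulr_suml -mulr_sumr b_unit mulr1.
    over.
  rewrite -mulr_suml -mulr_sumr a_unit mulr1.
  over.
by rewrite -mulr_suml a_unit mul1r.
Qed.

(** The Rademacher chaos left after the pairings are removed has second moment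
    at most [4 ^ 4 * delta ^ 2]. *)
Lemma rade_sketch_fourth_r (delta : R) : 0 < delta -> (forall j, `|b j| <= delta) ->
  rade (fun e => `|N^-1 * (\sum_i (sketch_coord a i e * sketch_coord b i e) ^+ 2)
                   - (1 + 2 * rho ^+ 2)|) <= 16 * delta + 2 * delta ^+ 2.
Proof.
move=> d0 b_small.
pose Q e := \sum_J beta J * sign_prod J e.
have b2 k : b k ^+ 2 <= delta ^+ 2.
  by rewrite -real_normK ?num_real // lerXn2r ?nnegrE // ltW.
have overlap : 0 <= \sum_j a j ^+ 2 * b j ^+ 2 <= delta ^+ 2.
  apply/andP; split; first by apply: sumr_ge0 => j _; rewrite mulr_ge0 ?sqr_ge0.
  rewrite -[leRHS]mul1r -a_unit mulr_suml; apply: ler_sum => j _.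
  by rewrite ler_wpM2l ?sqr_ge0.
(* As the mean of [Q ^ 2] is at most [(16 * delta) ^ 2], the bound
   [`|Q| <= Q ^ 2 / (32 * delta) + 8 * delta] loses nothing. *)
apply: (@le_trans _ _
    (rade (fun e => (32 * delta)^-1 * Q e ^+ 2 + (8 * delta + 2 * delta ^+ 2)))).
  apply: bern_le half01 _ => e; rewrite sketch_fourth_split -/(Q e).
  apply: (@le_trans _ _ (`|Q e| + 2 * delta ^+ 2)).
    rewrite (_ : _ - _ = Q e - 2 * \sum_j a j ^+ 2 * b j ^+ 2); last by ring.
    apply: le_trans (ler_normB _ _) _; rewrite lerD2l.
    by case/andP: overlap => ? ?; rewrite ger0_norm; lra.
  rewrite addrA lerD2r.
  have d32 : 0 < 32 * delta by lra.
  rewrite -(ler_pM2l d32) mulrDr mulVKf ?gt_eqF //.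
  rewrite -[Q e ^+ 2]real_normK ?num_real //.
  have := sqr_ge0 (`|Q e| - 16 * delta); lra.
rewrite bernD bern_cst bernZ.
have : rade (fun e => Q e ^+ 2) <= (4 ^ 4)%:R * delta ^+ 2.
  apply: le_trans (rade_chaos_sqr _) _.
    by move=> J /negbTE Jinj; rewrite /beta Jinj.
  by rewrite ler_wpM2l ?ler0n // beta_sqr_sum_le.
rewrite natrX => EQ.
have : (32 * delta)^-1 * rade (fun e => Q e ^+ 2) <=
       (32 * delta)^-1 * (4%:R ^+ 4 * delta ^+ 2).
  by rewrite ler_wpM2l ?invr_ge0 //; lra.
rewrite (_ : (32 * delta)^-1 * (4%:R ^+ 4 * delta ^+ 2) = 8 * delta); first by lra.
by field; rewrite gt_eqF.
Qed.

End hadamard_chaos.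

(** * The Gaussian density *)

Section gaussian_integrals.
Context {R : realType}.
Local Notation mu := (@lebesgue_measure R).

Definition gauss (x : R) : R := normal_pdf 0 1 x.

Lemma gauss_shiftE (m x : R) :
  normal_pdf m 1 x = normal_peak 1 * expR (- (x - m) ^+ 2 / 2).
Proof. by rewrite normal_pdfE ?oner_eq0 //= /normal_fun expr1n. Qed.

Lemma gaussE (x : R) : gauss x = normal_peak 1 * expR (- x ^+ 2 / 2).
Proof. by rewrite /gauss gauss_shiftE subr0. Qed.

Lemma gauss_gt0 (x : R) : 0 < gauss x.
Proof. by rewrite gaussE mulr_gt0 ?expR_gt0 // normal_peak_gt0 ?oner_eq0. Qed.

Lemma is_derive_gauss (x : R) : is_derive x 1 gauss (- x * gauss x).
Proof.
have dsq : is_derive x 1 (fun y : R => - y ^+ 2 / 2) (- x).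
  rewrite (_ : (fun y : R => - y ^+ 2 / 2) = (- 2^-1 : R) *: (@GRing.exp R ^~ 2)).
    apply: is_derive_eq; rewrite /GRing.scale /=; lra.
  apply/funext => y; rewrite !fctE /GRing.scale /=. by field.
have dexp : is_derive x 1 (expR \o (fun y : R => - y ^+ 2 / 2))
    (expR (- x ^+ 2 / 2) * - x).
  exact: is_derive1_comp.
rewrite (_ : gauss = normal_peak (1 : R) *: (expR \o (fun y : R => - y ^+ 2 / 2))).
  by apply: is_derive_eq; rewrite ?fctE /GRing.scale /=; ring.
by apply/funext => y; rewrite gaussE.
Qed.

Lemma integrable_gauss (D : set R) : measurable D -> mu.-integrable D (EFin \o gauss).
Proof.
move=> mD; apply: (@integrableS _ _ _ _ setT) => //.
exact: integrable_normal_pdf.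
Qed.

Lemma integrable_bounded_gauss (h : R -> R) (M : R) (D : set R) :
  measurable D -> continuous h -> (forall x, `|h x| <= M) ->
  mu.-integrable D (EFin \o (fun x => h x * gauss x)).
Proof.
move=> mD ch hM.
have -> : EFin \o (fun x => h x * gauss x) = ((EFin \o gauss) \* (EFin \o h))%E.
  by apply/funext => x /=; rewrite -EFinM mulrC.
apply: integrableMl => //; first exact: integrable_gauss.
  by apply: (measurable_funS measurableT) => //; exact: continuous_measurable_fun.
exists M; split; first by rewrite num_real.
by move=> y My x _ /=; apply: le_trans (hM x) (ltW My).
Qed.

(** The law is dominated by Lebesgue measure, with density [gauss]. *)
Lemma integral_normal_prob (h : R -> R) (M : R) :
  continuous h -> (forall x, `|h x| <= M) ->
  (\int[normal_prob 0 1]_x (h x)%:E = (\int[mu]_x (h x * gauss x))%:E)%E.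
Proof.
move=> ch hM; have mh := continuous_measurable_fun ch.
have inth : (normal_prob 0 1).-integrable [set: R] (EFin \o h).
  apply: measurable_bounded_integrable => //.
    by rewrite [X in (X < _)%E](_ : _ = 1%E) ?ltry //; exact: integral_normal_pdf.
  exists M; split; first by rewrite num_real.
  by move=> y My x _ /=; apply: le_trans (hM x) (ltW My).
have dom := @normal_prob_dominates R 0 1.
transitivity (\int[mu]_x ((h x)%:E * (gauss x)%:E))%E.
  rewrite -(Radon_Nikodym_change_of_variables dom) //=.
  apply: ae_eq_integral => //.
  - apply: emeasurable_funM; first exact/measurable_EFinP.
    by apply: (measurable_int mu); exact: Radon_Nikodym_integrable.
  - apply: emeasurable_funM; apply/measurable_EFinP => //.
    exact: measurable_normal_pdf.
  - apply: ae_eqe_mul2l => /=.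
    rewrite Radon_NikodymE //=; case: cid => /= f [f0 fint fE].
    apply: integral_ae_eq => //=.
      by apply/measurable_EFinP; exact: measurable_normal_pdf.
    by move=> E _ mE; rewrite -fE.
rewrite /Rintegral fineK.
  by apply: eq_integral => x _; rewrite EFinM.
apply: (integrable_fin_num measurableT).
exact: integrable_bounded_gauss ch hM.
Qed.

Lemma Rintegral_gauss : \int[mu]_x gauss x = 1.
Proof. by rewrite /Rintegral integral_normal_pdf. Qed.

(** On [D] one has [t ^ 2 >= x ^ 2 + (t - x) ^ 2], hence
    [gauss t <= gauss x / gauss 0 * gauss (t - x)]. *)
Lemma gauss_tail (x : R) (D : set R) : measurable D ->
  (forall t, D t -> 0 <= x * (t - x)) ->
  \int[mu]_(t in D) gauss t <= gauss x / gauss 0.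
Proof.
move=> mD Dx.
have peak0 := normal_peak_gt0 (oner_neq0 R).
have iM : mu.-integrable setT (EFin \o normal_pdf x 1) by exact: integrable_normal_pdf.
apply: (@le_trans _ _ (\int[mu]_(t in D) (gauss x / gauss 0 * normal_pdf x 1 t))).
  apply: le_Rintegral => //; first exact: integrable_gauss.
    rewrite (_ : EFin \o _ = (fun t => (gauss x / gauss 0)%:E * (normal_pdf x 1 t)%:E)%E).
      by apply: integrableZl => //; exact: integrableS iM.
    by apply/funext => t /=; rewrite EFinM.
  move=> t Dt; rewrite !gaussE gauss_shiftE expr0n /= oppr0 mul0r expR0 mulr1.
  rewrite [leRHS](_ : _ = normal_peak 1 *
    (expR (- x ^+ 2 / 2) * expR (- (t - x) ^+ 2 / 2))); last first.
    by field; rewrite gt_eqF.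
  rewrite ler_wpM2l ?(ltW peak0) // -expRD ler_expR.
  by have := Dx t Dt; lra.
rewrite RintegralZl //; last exact: integrableS iM.
rewrite ler_piMr ?divr_ge0 ?(ltW (gauss_gt0 _)) // /Rintegral.
rewrite [leRHS](_ : 1 = fine (\int[mu]_t (normal_pdf x 1 t)%:E)%E); last first.
  by rewrite integral_normal_pdf.
rewrite fine_le //.
- by apply: integrable_fin_num => //; exact: integrableS iM.
- exact: integrable_fin_num.
- apply: ge0_subset_integral => //.
    by apply/measurable_EFinP; exact: measurable_normal_pdf.
  by move=> t _; rewrite lee_fin normal_pdf_ge0.
Qed.

End gaussian_integrals.

(** * Calculus lemmas *)

Section calculus_lemmas.
Context {R : realType}.

Lemma is_derive_quadratic_error (f : R -> R) (x a C : R) :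
  (forall z, `|f z - f x - a * (z - x)| <= C * (z - x) ^+ 2) -> is_derive x 1 f a.
Proof.
move=> fC; apply/is_derive1_caratheodory.
pose g z := if z == x then a else (f z - f x) / (z - x).
have gC z : `|a - g z| <= C * `|z - x|.
  rewrite /g; case: eqVneq => [->|zx]; first by rewrite !subrr normr0 mulr0.
  have zx0 : 0 < `|z - x| by rewrite normr_gt0 subr_eq0.
  rewrite -(ler_pM2r zx0) -normrM -mulrA -expr2 real_normK ?num_real //.
  by rewrite mulrBl divfK ?subr_eq0 // distrC.
exists g; split; last by rewrite /g eqxx.
  move=> z; rewrite /g; case: eqVneq => [->|zx]; first by rewrite !subrr mulr0.
  by rewrite divfK // subr_eq0.
have gx : g x = a by rewrite /g eqxx.
apply/cvgrPdist_lt => e e0; rewrite gx; near=> z.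
apply: le_lt_trans (gC z) _.
have zd : `|x - z| < e / (`|C| + 1).
  near: z; apply: (@cvgr_dist_lt _ _ _ (nbhs x) _ id) => //.
  by rewrite divr_gt0 // ltr_wpDl.
rewrite distrC in zd; move: zd; rewrite ltr_pdivlMr ?ltr_wpDl // => zd.
apply: le_lt_trans zd; rewrite mulrC ler_wpM2l //.
by rewrite (le_trans (ler_norm _)) // lerDl.
Unshelve. all: by end_near. Qed.

(** Uniform continuity in a form that can be averaged: at distance at least the
    modulus [d], the oscillation [2 * M] is at most [2 * M * (x - y) ^ 2 / d ^ 2]. *)
Lemma compact_support_modulus (g : R -> R) (B : R) :
  continuous g -> 0 < B -> (forall x, B <= `|x| -> g x = 0) ->
  exists2 M, forall x, `|g x| <= M & forall delta, 0 < delta ->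
    exists2 C, 0 <= C & forall x y, `|g x - g y| <= delta + C * (x - y) ^+ 2.
Proof.
move=> cg B0 g0.
have cnorm : continuous (fun x => `|g x|).
  by move=> x; apply: (@cvg_norm _ _ _ (nbhs x)); exact: cg.
have [c _ cmax] : exists2 c, c \in `[-B, B] &
    forall t, t \in `[-B, B] -> `|g t| <= `|g c|.
  by apply: EVT_max; [lra | exact: continuous_subspaceT].
pose M := `|g c|.
have gM x : `|g x| <= M.
  have [xB|/g0 ->] := ltP `|x| B; last by rewrite normr0 normr_ge0.
  by apply: cmax; rewrite in_itv /= -ler_norml; exact: ltW.
exists M => // delta delta0.
have [d [d0 d1] gd] : exists2 d, 0 < d /\ d < 1 &
    forall x y, `|x - y| < d -> `|g x - g y| < delta.
  have near_d : \forall d \near (0^'+ : set_system R), `[- (B + 1), B + 1]%classic `<=`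
      (fun x => forall y, `|x - y| < d -> `|g x - g y| < delta).
    apply: (iffLR (compact_near_coveringP _) (@segment_compact R _ _)) => x _.
    have d2 : 0 < delta / 2 by rewrite divr_gt0.
    have /cvgrPdist_lt /(_ _ d2) /nbhs_ballP[r /= r0 xr] := cg x.
    have r2 : 0 < r / 2 by rewrite divr_gt0.
    near=> x' d => y x'y.
    have x'x : `|x - x'| < r / 2.
      by near: x'; apply: (@cvgr_dist_lt _ _ _ (nbhs x) _ id).
    have dr : d < r / 2 by near: d; exact: nbhs_right_lt.
    have gx' : `|g x - g x'| < delta / 2.
      by apply: xr; rewrite /ball /= (lt_trans x'x) // ltr_pdivrMr // ltr_pMr // ltr1n.
    have gy : `|g x - g y| < delta / 2.
      apply: xr; rewrite /ball /= [ltRHS]splitr -(subrK x' x) -addrA.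
      by apply: le_lt_trans (ler_normD _ _) _; rewrite ltrD // (lt_trans x'y).
    rewrite -(subrK (g x) (g x')) -addrA [ltRHS]splitr.
    by apply: le_lt_trans (ler_normD _ _) _; rewrite ltrD // distrC.
  have : \forall d \near (0^'+ : set_system R), [/\ 0 < d, d < 1 &
     `[- (B + 1), B + 1]%classic `<=`
     (fun x => forall y, `|x - y| < d -> `|g x - g y| < delta)].
    near=> d; split; [by []| |by near: d].
    by near: d; apply: nbhs_right_lt.
  move=> /filter_ex[d [d0 d1 Hd]]; exists d => // x y xy.
  have [xB|xB] := leP `|x| (B + 1).
    by apply: (Hd x) => //; rewrite /= in_itv /= -ler_norml.
  have yB : B <= `|y|.
    have := ler_normD (x - y) y; rewrite subrK; lra.
  by rewrite !g0 // ?subrr ?normr0 //; lra.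
exists (2 * M / d ^+ 2).
  by rewrite divr_ge0 ?sqr_ge0 // mulr_ge0 ?normr_ge0 //.
move=> x y; have [xy|xy] := ltP `|x - y| d.
  rewrite (le_trans (ltW (gd _ _ xy))) // lerDl mulr_ge0 ?sqr_ge0 //.
  by rewrite divr_ge0 ?sqr_ge0 // mulr_ge0 ?normr_ge0.
apply: (@le_trans _ _ (2 * M)).
  by apply: le_trans (ler_normB _ _) _; have := gM x; have := gM y; lra.
rewrite -[leLHS]add0r lerD ?(ltW delta0) // mulrAC ler_pdivlMr ?exprn_gt0 //.
rewrite ler_wpM2l ?mulr_ge0 ?normr_ge0 //.
by rewrite -[leRHS]real_normK ?num_real // lerXn2r ?nnegrE // (ltW d0).
Unshelve. all: by end_near. Qed.

(** A function of class C^1 vanishing on the negative half-line, from which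
    compactly supported cutoffs are made. *)
Definition pos_sqr (y : R) : R := Num.max 0 y ^+ 2.

Lemma is_derive_pos_sqr (y : R) : is_derive y 1 pos_sqr (2 * Num.max 0 y).
Proof.
apply: (@is_derive_quadratic_error _ _ _ 1) => z; rewrite mul1r /pos_sqr ler_norml.
have zy := sqr_ge0 (z - y).
by case: (leP 0 y) => y0; case: (leP 0 z) => z0; apply/andP; split; nra.
Qed.

Lemma continuous_of_derive (f f' : R -> R) :
  (forall x : R, is_derive x 1 f (f' x)) -> continuous f.
Proof.
move=> df x; apply: differentiable_continuous; apply/derivable1_diffP.
by case: (df x).
Qed.

End calculus_lemmas.

(** * Stein's equation *)

Section stein_equation.
Context {R : realType} (h : R -> R) (M : R).
Hypothesis h_cont : continuous h.
Hypothesis h_bounded : forall x, `|h x| <= M.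
Local Notation mu := (@lebesgue_measure R).

Let c : R := \int[mu]_x (h x * gauss x).

Let g (t : R) : R := (h t - c) * gauss t.

Let U (x : R) : R := \int[mu]_(t in `]-oo, x]) g t.

Lemma gauss_mean_bounded : `|c| <= M.
Proof.
have ih := integrable_bounded_gauss measurableT h_cont h_bounded.
apply: le_trans (le_normr_Rintegral _ ih) _ => //.
rewrite -[leRHS]mulr1 -(@Rintegral_gauss R) -RintegralZl //; last exact: integrable_gauss.
apply: le_Rintegral => //.
- exact: (integrable_norm ih).
- rewrite (_ : EFin \o _ = (fun t => M%:E * (gauss t)%:E)%E).
    by apply: integrableZl => //; exact: integrable_gauss.
  by apply/funext => t /=; rewrite EFinM.
- move=> x _; rewrite normrM [`|gauss x|]gtr0_norm ?gauss_gt0 //.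
  by rewrite ler_wpM2r // ltW // gauss_gt0.
Qed.

Lemma centered_bounded x : `|h x - c| <= 2 * M.
Proof.
apply: le_trans (ler_normB _ _) _.
by have := h_bounded x; have := gauss_mean_bounded; lra.
Qed.

Lemma centered_continuous : continuous (fun x => h x - c).
Proof. by move=> x; apply: cvgB; [exact: h_cont | exact: cvg_cst]. Qed.

Lemma integrable_centered (D : set R) : measurable D -> mu.-integrable D (EFin \o g).
Proof.
by move=> mD; apply: integrable_bounded_gauss centered_continuous centered_bounded.
Qed.

Lemma Rintegral_centered : \int[mu]_t g t = 0.
Proof.
have ih := integrable_bounded_gauss measurableT h_cont h_bounded.
have ig : mu.-integrable setT (EFin \o gauss) by exact: integrable_gauss.
rewrite (_ : \int[mu]_t g t = \int[mu]_t (h t * gauss t - c * gauss t)); last first.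
  by apply: eq_Rintegral => t _; rewrite /g mulrBl.
rewrite RintegralB //.
  by rewrite RintegralZl // Rintegral_gauss mulr1 subrr.
rewrite (_ : EFin \o _ = (fun t => c%:E * (gauss t)%:E)%E); first exact: integrableZl.
by apply/funext => t /=; rewrite EFinM.
Qed.

Lemma Rintegral_centered_le (x : R) (D : set R) : measurable D ->
  (forall t, D t -> 0 <= x * (t - x)) ->
  `|\int[mu]_(t in D) g t| <= 2 * M * (gauss x / gauss 0).
Proof.
move=> mD Dx; have iD := integrable_centered mD.
apply: le_trans (le_normr_Rintegral _ iD) _ => //.
apply: (@le_trans _ _ (\int[mu]_(t in D) (2 * M * gauss t))).
  apply: le_Rintegral => //; first exact: (integrable_norm iD).
    rewrite (_ : EFin \o _ = (fun t => (2 * M)%:E * (gauss t)%:E)%E).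
      by apply: integrableZl => //; exact: integrable_gauss.
    by apply/funext => t /=; rewrite EFinM.
  move=> t _; rewrite /g normrM [`|gauss t|]gtr0_norm ?gauss_gt0 //.
  by rewrite ler_wpM2r ?centered_bounded // ltW // gauss_gt0.
rewrite RintegralZl //; last exact: integrable_gauss.
rewrite ler_wpM2l ?gauss_tail //.
by rewrite (le_trans _ (centered_bounded 0)).
Qed.

(** For [x <= 0] this is the tail bound on [U] itself; for [0 <= x] the tail
    bound applies to the complementary integral, since [g] has integral zero. *)
Lemma centered_primitive_bounded x : `|U x| <= 2 * M * (gauss x / gauss 0).
Proof.
have [x0|x0] := leP x 0.
  apply: Rintegral_centered_le => // t; rewrite /= in_itv /= => tx; nra.
have -> : U x = - \int[mu]_(t in `]x, +oo[) g t.
  have := @Rintegral_itvB R g -oo%O +oo%O x.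
  rewrite set_itvNyy Rintegral_centered sub0r => <- //; first by rewrite opprK.
  exact: integrable_centered.
rewrite normrN; apply: Rintegral_centered_le => // t; rewrite /= in_itv /= andbT => xt.
by rewrite mulr_ge0 // ?subr_ge0 ltW.
Qed.

Lemma is_derive_centered_primitive (x : R) : is_derive x 1 U (g x).
Proof.
have cg : {for x, continuous g}.
  apply: (@cvgM _ _ (nbhs x)); first exact: centered_continuous.
  exact: (continuous_of_derive (@is_derive_gauss R)).
have xx1 : x < x + 1 by rewrite ltrDl.
have [dU dUE] := @continuous_FTC1 R g -oo%O x (x + 1) xx1
  (integrable_centered (measurable_itv _)) (ltNyr x) cg.
by rewrite derive1E in dUE; exact: DeriveDef dU dUE.
Qed.

(** The solution is [U / gauss], because the derivative of [gauss] at [x] is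
    [- x * gauss x]. *)
Lemma stein_solution : exists2 u : R -> R,
  forall x : R, is_derive x 1 u (h x - c + x * u x) &
  exists C : R, forall x, `|u x| <= C.
Proof.
exists (fun x => U x / gauss x).
  move=> x; have dU := is_derive_centered_primitive x.
  have gx0 : gauss x != 0 by rewrite gt_eqF ?gauss_gt0.
  have dV := is_deriveV gx0 (is_derive_gauss x).
  apply: (is_derive_eq (is_deriveM dU dV)).
  by rewrite /GRing.scale /= /g; field.
exists (2 * M / gauss 0) => x.
rewrite normrM normfV [`|gauss x|]gtr0_norm ?gauss_gt0 // ler_pdivrMr ?gauss_gt0 //.
by rewrite mulrAC -mulrA centered_primitive_bounded.
Qed.

(** [f] is the bounded solution of Stein's equation cut off by
    [pos_sqr (1 - k * x ^ 2)], with [k] small. *)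
Lemma stein_test_function (eps : R) : 0 < eps ->
  exists (f f' : R -> R) (B : R),
  [/\ forall x : R, is_derive x 1 f (f' x), forall x, `|f' x| <= B,
      forall delta, 0 < delta -> exists2 C, 0 <= C &
        forall x y, `|f' x - f' y| <= delta + C * (x - y) ^+ 2 &
      forall x, `|h x - c - (f' x - x * f x)| <= eps * (1 + x ^+ 2)].
Proof.
move=> eps0; have [u du [C uC]] := stein_solution.
have M0 : 0 <= M by exact: le_trans (h_bounded 0).
have C0 : 0 <= C by exact: le_trans (uC 0).
pose k := eps / (4 * M + 4 * C + 1); have k0 : 0 < k by rewrite divr_gt0 //; lra.
have kE : k * (4 * M + 4 * C + 1) = eps by rewrite divfK // gt_eqF //; lra.
clearbody k.
pose chi (x : R) : R := pos_sqr (1 - k * x ^+ 2).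
pose chi' (x : R) : R := 2 * Num.max 0 (1 - k * x ^+ 2) * (- (2 * k * x)).
have dchi x : is_derive (x : R) 1 chi (chi' x).
  have dq : is_derive (x : R) 1 (fun x => 1 - k * x ^+ 2) (- (2 * k * x)).
    rewrite (_ : (fun x => _) = cst 1 - k *: (@GRing.exp R ^~ 2)); last first.
      by apply/funext => y; rewrite !fctE.
    by apply: is_derive_eq; rewrite /GRing.scale /=; ring.
  exact: is_derive1_comp (is_derive_pos_sqr _) dq.
pose f (x : R) : R := chi x * u x.
pose f' (x : R) : R := chi x * (h x - c + x * u x) + u x * chi' x.
have df x : is_derive (x : R) 1 f (f' x) by exact: is_deriveM.
have cf' : continuous f'.
  have cu := continuous_of_derive du; have cchi := continuous_of_derive dchi.
  have cmax : continuous (fun x : R => Num.max 0 (1 - k * x ^+ 2)).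
    move=> x; apply: (@continuous_max _ _ (cst 0) (fun x : R => 1 - k * x ^+ 2)).
      exact: cst_continuous.
    apply: cvgB; first exact: cvg_cst.
    by apply: cvgMr; exact: exprn_continuous.
  move=> x; apply: cvgD; apply: cvgM.
  - exact: cchi.
  - apply: cvgD; first exact: centered_continuous.
    by apply: cvgM; [exact: cvg_id | exact: cu].
  - exact: cu.
  - apply: cvgM; first by apply: cvgMr; exact: cmax.
    by apply: cvgN; apply: cvgMr; exact: cvg_id.
have f'0 x : 1 + k^-1 <= `|x| -> f' x = 0.
  move=> xB; have : 1 <= k * x ^+ 2.
    rewrite -[x ^+ 2]real_normK ?num_real //.
    have k1 : 0 < k^-1 by rewrite invr_gt0.
    apply: (@le_trans _ _ (k * (1 + k^-1) ^+ 2)).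
      rewrite (_ : k * _ = k + 2 + k^-1); first by lra.
      by field; rewrite gt_eqF.
    by rewrite ler_wpM2l ?(ltW k0) // lerXn2r ?nnegrE // addr_ge0 // ltW.
  move=> kx; rewrite /f' /chi /chi' /pos_sqr (max_l _) ?expr0n /=; first by ring.
  by rewrite subr_le0.
have B0 : 0 < 1 + k^-1 by rewrite addr_gt0 // invr_gt0.
have [B f'B modf'] := compact_support_modulus cf' B0 f'0.
exists f, f', B; split => // x.
(* The two error terms of the cutoff are of order [k * (1 + x ^ 2)]. *)
have -> : h x - c - (f' x - x * f x) = (1 - chi x) * (h x - c) - u x * chi' x.
  by rewrite /f' /f; ring.
have x2 : 0 <= k * x ^+ 2 by rewrite mulr_ge0 ?sqr_ge0 // ltW.
have chi1 : `|1 - chi x| <= 2 * (k * x ^+ 2).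
  rewrite /chi /pos_sqr ler_norml; move: (k * x ^+ 2) x2 => q q0.
  case: (leP 0 (1 - q)) => q1; last by apply/andP; split; lra.
  by have qq := mulr_ge0 q0 q1; have q2 := sqr_ge0 q; apply/andP; split; nra.
have chi'1 : `|chi' x| <= 4 * k * (1 + x ^+ 2).
  rewrite /chi' normrM normrN [`|2 * k * x|]normrM.
  rewrite (gtr0_norm (_ : 0 < 2 * k)); last by lra.
  apply: (@le_trans _ _ (2 * (2 * k * `|x|))).
    apply: ler_wpM2r; first by rewrite mulr_ge0 //; lra.
    by rewrite ger0_norm; case: (leP 0 (1 - k * x ^+ 2)) => kx; lra.
  have := sqr_ge0 (`|x| - 1); have := sqr_ge0 x.
  rewrite -(real_normK (num_real x)) => ? ?.
  by nra.
apply: le_trans (ler_normB _ _) _; rewrite (normrM (1 - _)) (normrM (u x)).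
apply: (@le_trans _ _ (2 * (k * x ^+ 2) * (2 * M) + C * (4 * k * (1 + x ^+ 2)))).
  apply: lerD; apply: ler_pM => //; exact: centered_bounded.
rewrite -kE; have Mk : 0 <= M * k by rewrite mulr_ge0 // ltW.
have := sqr_ge0 x; nra.
Qed.

End stein_equation.

(** * Expectations as finite sums *)

Section discrete_expectation.
Context d (T : measurableType d) (R : realType) (P : probability T R).

(** The events have total mass one, so [X] is almost surely the simple function
    with value [x k] on [A k]. *)
Lemma expectation_discrete (K : finType) (A : K -> set T) (x : K -> R) (X : T -> R) :
  (forall k, measurable (A k)) ->
  (forall k k' w, A k w -> A k' w -> k = k') ->
  (\sum_k P (A k) = 1)%E ->
  measurable_fun setT X -> (forall k w, A k w -> X w = x k) ->
  ('E_P[X] = \sum_k (x k)%:E * P (A k))%E.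
Proof.
move=> mA Adisj A1 mX XA; rewrite unlock.
have indicE k k' w : A k w -> \1_(A k') w = (k == k')%:R :> R.
  move=> Akw; rewrite indicE; case: eqVneq => [<-|kk']; first by rewrite mem_set.
  rewrite memNset // => Ak'w; move: kk'; rewrite (Adisj _ _ _ Akw Ak'w).
  by rewrite eqxx.
pose Y w : R := \sum_k x k * \1_(A k) w.
transitivity (\int[P]_w (Y w)%:E)%E.
  apply: ae_eq_integral => //; first exact/measurable_EFinP.
    apply/measurable_EFinP; apply: measurable_sum => k.
    by apply: measurable_funM => //; exact: measurable_indic.
  pose V := \bigcup_(k in [set` index_enum K]) A k.
  have mV : measurable V by apply: fin_bigcup_measurable => // k _; exact: mA.
  have V1 : P V = 1%E.
    rewrite measure_fin_bigcup //; last first.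
      by move=> k k' _ _ [w [Akw Ak'w]]; exact: Adisj Akw Ak'w.
    by rewrite -fsbig_seq ?index_enum_uniq.
  exists (~` V); split; first exact: measurableC.
    by have := probability_setC P mV; rewrite V1 subee.
  move=> w; apply: contra_not => -[k _ Akw] _ /=.
  rewrite (XA _ _ Akw) /Y (bigD1 k) //= (indicE _ _ _ Akw) eqxx mulr1.
  rewrite big1 ?addr0 // => k' k'k.
  by rewrite (indicE _ _ _ Akw) eq_sym (negbTE k'k) mulr0.
under eq_integral do rewrite /Y -sumEFin.
have intI k : P.-integrable setT (fun w => (\1_(A k) w)%:E).
  by apply: integrable_indic => //; exact: mA.
rewrite integral_sum //; last first.
  by move=> k; under eq_fun do rewrite EFinM; exact: integrableZl.
apply: eq_bigr => k _; under eq_integral do rewrite EFinM.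
by rewrite integralZl // integral_indic // setIT.
Qed.

Lemma expectation_srht (n m : nat) (B D : 'I_n -> {RV P >-> R})
    (F : ('I_n -> R) -> ('I_n -> R) -> R) :
  srht_entries m B D ->
  measurable_fun setT (fun w => F (fun i => B i w) (fun i => D i w)) ->
  ('E_P[fun w => F (fun i => B i w) (fun i => D i w)])%E =
  (bern (2^-1 : R) (fun e : {ffun 'I_n -> bool} =>
    bern (m%:R / n%:R : R) (fun b : {ffun 'I_n -> bool} =>
      F (fun i => (b i)%:R) (fun i => bool_sign (e i)))))%:E.
Proof.
case=> indep lawB lawD mF; set p : R := _ / _.
pose X (k : 'I_n + 'I_n) : {RV P >-> R} :=
  match k with inl i => B i | inr i => D i end.
pose val (eb : {ffun 'I_n -> bool} * {ffun 'I_n -> bool}) (k : 'I_n + 'I_n) : R :=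
  match k with inl i => (eb.2 i)%:R | inr i => bool_sign (eb.1 i) end.
pose A eb := \bigcap_(k in [set` [set: 'I_n + 'I_n]%SET]) X k @^-1` [set val eb k].
have AE eb w : A eb w -> forall k, X k w = val eb k.
  by move=> Aw k; apply: Aw; rewrite /= inE.
have PA eb : P (A eb) = (bern_weight (2^-1) eb.1 * bern_weight p eb.2)%:E.
  rewrite /A (indep _ (fun k => [set val eb k])) // big_sumType /=.
  rewrite mulrC EFinM /bern_weight; congr (_ * _)%E.
    rewrite -prodEFin; apply: eq_big => i; first by rewrite inE.
    by move=> _; have [B1 B0] := lawB i; case: (eb.2 i).
  rewrite -prodEFin; apply: eq_big => i; first by rewrite inE.
  move=> _; have [D1 D0] := lawD i; case: (eb.1 i) => //=.
  by rewrite D0; congr EFin; field.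
rewrite (@expectation_discrete _ A
  (fun eb => F (fun i => (eb.2 i)%:R) (fun i => bool_sign (eb.1 i)))) //.
- under eq_bigr => eb _ do rewrite PA -EFinM.
  rewrite sumEFin; congr EFin; rewrite -(pair_big xpredT xpredT
    (fun e b : {ffun 'I_n -> bool} => F (fun i => (b i)%:R) (fun i => bool_sign (e i)) *
       (bern_weight 2^-1 e * bern_weight p b))) /=.
  apply: eq_bigr => e _; rewrite /bern mulr_sumr; apply: eq_bigr => b _.
  by ring.
- by move=> eb; apply: fin_bigcap_measurable => // k _; exact: measurable_funPTI.
- move=> [e b] [e' b'] w /AE Aw /AE A'w.
  have eE : e = e'.
    apply/ffunP => i; have := Aw (inr i); rewrite A'w /=.
    by case: (e i); case: (e' i) => //= sgn; exfalso; lra.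
  have bE : b = b'.
    apply/ffunP => i; have := Aw (inl i); rewrite A'w /=.
    by case: (b i); case: (b' i) => //= /eqP; rewrite ?oner_eq0 // eq_sym oner_eq0.
  by rewrite eE bE.
- under eq_bigr => eb _ do rewrite PA.
  rewrite sumEFin; congr EFin; rewrite -(pair_big xpredT xpredT
    (fun e b : {ffun 'I_n -> bool} => bern_weight 2^-1 e * bern_weight p b)) /=.
  under eq_bigr => e _ do rewrite -mulr_sumr bern_weight_sum mulr1.
  exact: bern_weight_sum.
- move=> [e b] w /AE Aw; congr F; apply/funext => i.
    exact: (Aw (inl i)).
  exact: (Aw (inr i)).
Qed.

End discrete_expectation.

(** * Hadamard matrices and the sketched inner product *)

Section hadamard_matrices.
Context {R : realType}.

Lemma castmx_mul_sq n n' (eq_n : n = n') (A B : 'M[R]_n) :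
  castmx (eq_n, eq_n) A *m castmx (eq_n, eq_n) B = castmx (eq_n, eq_n) (A *m B).
Proof. by subst n'; rewrite !castmx_id. Qed.

Lemma castmx_scalar_sq n n' (eq_n : n = n') (c : R) :
  castmx (eq_n, eq_n) (c%:M : 'M[R]_n) = c%:M.
Proof. by subst n'; rewrite castmx_id. Qed.

Lemma hadamard_tr t : (hadamard R t)^T = hadamard R t.
Proof.
elim: t => [|t IHt] /=; first exact: trmx1.
by rewrite trmx_cast linearZ /= tr_block_mx linearN /= IHt.
Qed.

Lemma hadamard_mul t : hadamard R t *m hadamard R t = 1%:M.
Proof.
elim: t => [|t IHt] /=; first exact: mulmx1.
rewrite castmx_mul_sq -scalemxAl -scalemxAr scalerA mulmx_block.
rewrite !mulmxN !mulNmx opprK IHt addrN -raddfD /= -scalar_mx_block.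
rewrite scale_scalar_mx castmx_scalar_sq; congr _%:M.
by rewrite -expr2 exprVn sqr_sqrtr ?ler0n // mulVf // pnatr_eq0.
Qed.

Lemma hadamard_entry_sqr t i j : hadamard R t i j ^+ 2 = (2 ^ t)%:R^-1.
Proof.
elim: t i j => [|t IHt] i j /=.
  by rewrite !ord1 mxE eqxx expr1n invr1.
rewrite castmxE mxE exprMn exprVn sqr_sqrtr ?ler0n //.
have -> : (block_mx (hadamard R t) (hadamard R t) (hadamard R t) (- hadamard R t))
   (cast_ord (esym (hadamard_dimE t)) i) (cast_ord (esym (hadamard_dimE t)) j) ^+ 2 =
   (2 ^ t)%:R^-1.
  rewrite /block_mx !mxE; case: fintype.split => i';
    rewrite !mxE; case: fintype.split => j';
  by rewrite ?mxE ?sqrrN IHt.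
by rewrite expnS natrM invfM.
Qed.

(** The Hadamard matrix rescaled to entries of absolute value one. *)
Definition walsh t (i j : 'I_(2 ^ t)) : R := Num.sqrt (2 ^ t)%:R * hadamard R t i j.

Lemma walsh_sqr t i j : @walsh t i j ^+ 2 = 1.
Proof.
rewrite /walsh exprMn sqr_sqrtr ?ler0n // hadamard_entry_sqr divff //.
Qed.

Lemma walsh_col t j k :
  \sum_i @walsh t i j * walsh i k = #|'I_(2 ^ t)|%:R * (j == k)%:R.
Proof.
have := congr1 (fun A : 'M[R]_(2 ^ t) => A j k) (hadamard_mul t).
rewrite -{1}hadamard_tr !mxE => <-; rewrite card_ord mulr_sumr.
apply: eq_bigr => i _; rewrite mxE /walsh mulrACA -expr2 sqr_sqrtr ?ler0n //.
Qed.

Lemma walsh_row t i k :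
  \sum_j @walsh t i j * walsh k j = #|'I_(2 ^ t)|%:R * (i == k)%:R.
Proof.
rewrite -walsh_col; apply: eq_bigr => j _.
rewrite /walsh -[in hadamard R t i j]hadamard_tr.
by rewrite -[in hadamard R t k j]hadamard_tr !mxE.
Qed.

Lemma dotvE n (u v : 'cV[R]_n) : dotv u v = \sum_j u j 0 * v j 0.
Proof. by rewrite /dotv mxE; apply: eq_bigr => j _; rewrite mxE. Qed.

Lemma norm2_sum n (v : 'cV[R]_n) : norm2 v = 1 -> \sum_j v j 0 ^+ 2 = 1.
Proof.
move=> /(congr1 (fun x => x ^+ 2)); rewrite expr1n sqr_sqrtr //.
by apply: sumr_ge0 => j _; exact: sqr_ge0.
Qed.

Lemma entry_le_normoo n (v : 'cV[R]_n) j : `|v j 0| <= normoo v.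
Proof.
by rewrite /normoo mx_normrE; apply/bigmax_geP; right; exists (j, 0).
Qed.

Lemma sketched_dotvE l m (b e : 'I_(2 ^ l) -> R) (u v : 'cV[R]_(2 ^ l)) :
  sketched_dotv (srht m b e) u v = m%:R^-1 * \sum_i b i ^+ 2 *
    ((\sum_j e j * (walsh i j * u j 0)) * (\sum_j e j * (walsh i j * v j 0))).
Proof.
pose n : R := (2 ^ l)%:R.
have n0 : 0 < n by rewrite ltr0n expn_gt0.
have coord (w : 'cV[R]_(2 ^ l)) i : (srht m b e *m w) i 0 =
    Num.sqrt (n / m%:R) * (Num.sqrt n)^-1 * b i * \sum_j e j * (walsh i j * w j 0).
  rewrite mxE mulr_sumr; apply: eq_bigr => j _.
  rewrite /srht -mulmxA !mxE (bigD1 i) //= big1 ?addr0; last first.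
    by move=> k ki; rewrite !mxE (eq_sym i) (negbTE ki) mulr0n mul0r.
  rewrite !mxE eqxx mulr1n (bigD1 j) //= big1 ?addr0; last first.
    by move=> k kj; rewrite !mxE (negbTE kj) mulr0n mulr0.
  rewrite !mxE eqxx mulr1n /walsh -/n; field.
  by rewrite gt_eqF // sqrtr_gt0.
rewrite /sketched_dotv -[u^T *m _ *m _ *m v]mulmxA -trmx_mul mxE mulr_sumr.
apply: eq_bigr => i _; rewrite mxE !coord.
rewrite [in RHS](_ : m%:R^-1 = (Num.sqrt (n / m%:R) * (Num.sqrt n)^-1) ^+ 2); first by ring.
rewrite exprMn exprVn !sqr_sqrtr ?divr_ge0 ?ler0n ?ltW //.
by rewrite mulrAC divff ?mul1r // gt_eqF.
Qed.

End hadamard_matrices.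

(** * Normal approximation for a fixed dimension *)

Section sketch_normal_approximation.
Context {R : realType} {I : finType} (h : I -> I -> R) (a b : I -> R).
Hypothesis h_sqr : forall i j, h i j ^+ 2 = 1.
Hypothesis h_col : forall j k, \sum_i h i j * h i k = #|I|%:R * (j == k)%:R.
Hypothesis h_row : forall i k, \sum_j h i j * h k j = #|I|%:R * (i == k)%:R.
Hypothesis a_unit : \sum_j a j ^+ 2 = 1.
Hypothesis b_unit : \sum_j b j ^+ 2 = 1.

Local Notation N := (#|I|%:R : R).
Local Notation rade := (bern (2^-1 : R)).
Let rho : R := \sum_j a j * b j.
Let w (i : I) (e : {ffun I -> bool}) : R := sketch_coord h a i e * sketch_coord h b i e.

Lemma sum_sketch_coordM e : \sum_i w i e = N * rho.
Proof.
transitivity (\sum_j \sum_k (bool_sign (e j) * a j) * (bool_sign (e k) * b k) *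
   \sum_i h i j * h i k).
  rewrite /w /sketch_coord /sign_sum.
  under eq_bigr => i _ do rewrite big_distrlr /=.
  rewrite exchange_big; apply: eq_bigr => j _ /=.
  rewrite exchange_big; apply: eq_bigr => k _ /=.
  by rewrite mulr_sumr; apply: eq_bigr => i _; ring.
rewrite mulr_sumr; apply: eq_bigr => j _; rewrite (bigD1 j) //= [X in _ + X]big1.
  rewrite h_col eqxx addr0 /=.
  transitivity (bool_sign (e j) ^+ 2 * (N * (a j * b j))); first by ring.
  by rewrite bool_sign_sqr mul1r.
by move=> k kj; rewrite h_col eq_sym (negbTE kj) !mulr0.
Qed.

Lemma rade_sketch_coord8 (u : I -> R) i : \sum_j u j ^+ 2 = 1 ->
  rade (fun e => sketch_coord h u i e ^+ 8) <= 105.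
Proof.
move=> u1; have [_ _ _] := rade_even_moments (fun j => h i j * u j) (index_enum_uniq I).
rewrite (eq_bigr (fun j => u j ^+ 2)) ?u1 ?expr1n ?mulr1 //.
by move=> j _; rewrite exprMn h_sqr mul1r.
Qed.

Lemma rade_sketch_prod4 i : rade (fun e => w i e ^+ 4) <= 105.
Proof.
apply: (@le_trans _ _ (rade (fun e => 2^-1 *
    (sketch_coord h a i e ^+ 8 + sketch_coord h b i e ^+ 8)))).
  apply: bern_le half01 _ => e; rewrite /w exprMn.
  have := sqr_ge0 (sketch_coord h a i e ^+ 4 - sketch_coord h b i e ^+ 4).
  rewrite sqrrB -!exprM /=; lra.
rewrite bernZ bernD.
have := rade_sketch_coord8 i a_unit; have := rade_sketch_coord8 i b_unit; lra.
Qed.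

Context (delta : R).
Hypothesis delta_gt0 : 0 < delta.
Hypothesis flat : (forall j, `|a j| <= delta) \/ (forall j, `|b j| <= delta).

(** The average and its limit are symmetric in the two vectors. *)
Lemma rade_sketch_fourth :
  rade (fun e => `|N^-1 * (\sum_i w i e ^+ 2) - (1 + 2 * rho ^+ 2)|) <=
  16 * delta + 2 * delta ^+ 2.
Proof.
case: flat => [a_flat|]; last exact: rade_sketch_fourth_r.
have := rade_sketch_fourth_r h_sqr h_col h_row b_unit a_unit delta_gt0 a_flat.
rewrite (eq_bigr (fun j => a j * b j)) -/rho; last by move=> j _; rewrite mulrC.
by under eq_bern => e do under eq_bigr => i _ do rewrite mulrC.
Qed.

Context (p kappa : R).
Hypothesis p01 : 0 < p < 1.
Hypothesis kappaE : kappa ^+ 2 = (p * N * (1 - p) * (1 + 2 * rho ^+ 2))^-1.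

Let Z (e c : {ffun I -> bool}) : R := centered_sum p (fun i => kappa * w i e) c.
Let V (e : {ffun I -> bool}) : R := p * (1 - p) * \sum_i (kappa * w i e) ^+ 2.
Let slack : R := 16 * delta + 2 * delta ^+ 2.

Let N0 : 0 < N := card_gt0_of_unit a_unit.

Let rho_gt0 : 1 <= 1 + 2 * rho ^+ 2.
Proof. by rewrite lerDl mulr_ge0 ?sqr_ge0. Qed.

Let p01w : 0 <= p <= 1.
Proof. by case/andP: p01 => ? ?; rewrite !ltW. Qed.

Lemma sketch_varianceE e : V e = N^-1 * (\sum_i w i e ^+ 2) / (1 + 2 * rho ^+ 2).
Proof.
rewrite /V; under eq_bigr => i _ do rewrite exprMn.
rewrite -mulr_sumr kappaE; case/andP: p01 => p0 p1.
by field; rewrite !gt_eqF //; move: rho_gt0; lra.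
Qed.

Lemma rade_variance_dev : rade (fun e => `|1 - V e|) <= slack.
Proof.
apply: le_trans rade_sketch_fourth; apply: bern_le half01 _ => e.
rewrite sketch_varianceE; set W := N^-1 * _; have r0 := rho_gt0; set r := 1 + _ in r0 *.
have -> : 1 - W / r = - ((W - r) / r) by field; rewrite gt_eqF //; lra.
rewrite normrN normrM ler_piMr // normfV ger0_norm ?invf_le1 //; lra.
Qed.

Lemma rade_variance : rade V <= 1 + slack.
Proof.
apply: (@le_trans _ _ (rade (fun e => 1 + `|1 - V e|))).
  apply: bern_le half01 _ => e.
  by have := ler_norm (V e - 1); rewrite distrC; lra.
by rewrite bernD bern_cst lerD2l rade_variance_dev.
Qed.

Lemma rade_fourth_power : rade (fun e => p * (1 - p) * \sum_i (kappa * w i e) ^+ 4) <=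
  105 / (p * N * (1 - p)).
Proof.
have [p0 p1] := andP p01; have q0 : 0 < 1 - p by rewrite subr_gt0.
have r0 : 0 < 1 + 2 * rho ^+ 2 by move: rho_gt0; lra.
rewrite bernZ bern_sum.
apply: (@le_trans _ _ (p * (1 - p) * \sum_(i : I) kappa ^+ 4 * 105)).
  apply: ler_wpM2l; first by rewrite mulr_ge0 ?ltW.
  apply: ler_sum => i _; under eq_bern => e do rewrite exprMn.
  rewrite bernZ; apply: ler_wpM2l; last exact: rade_sketch_prod4.
  by rewrite (exprM _ 2 2) sqr_ge0.
rewrite sumr_const -[_ *+ _]mulr_natl (exprM _ 2 2) kappaE.
have -> : p * (1 - p) * (N * (((p * N * (1 - p) * (1 + 2 * rho ^+ 2))^-1) ^+ 2 * 105)) =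
   105 / (p * N * (1 - p)) * ((1 + 2 * rho ^+ 2) ^+ 2)^-1.
  by field; rewrite !gt_eqF.
rewrite ler_piMr //; first by rewrite divr_ge0 ?mulr_ge0 ?ltW.
by rewrite invf_le1 ?exprn_gt0 // exprn_ege1.
Qed.

Lemma sketch_second_moment : rade (fun e => bern p (fun c => Z e c ^+ 2)) <= 1 + slack.
Proof.
apply: le_trans rade_variance; rewrite le_eqVlt; apply/orP; left; apply/eqP.
by apply: eq_bern => e; exact: bern_centered_sum_sqr.
Qed.

(** Stein's method: [phi] differs from its Gaussian mean [c] by [f' - id * f] up
    to [eta], and [stein_bern] applies for each fixed value of the signs. *)
Lemma sketch_normal_distance (phi f f' : R -> R) (c eta B eps C : R) :
  (forall x : R, is_derive x 1 f (f' x)) -> (forall x, `|f' x| <= B) ->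
  (forall x y, `|f' x - f' y| <= eps + C * (x - y) ^+ 2) ->
  (forall x, `|phi x - c - (f' x - x * f x)| <= eta * (1 + x ^+ 2)) ->
  0 <= C -> 0 <= eps -> 0 <= eta ->
  `|rade (fun e => bern p (fun u => phi (Z e u))) - c| <=
  eta * (2 + slack) + B * slack + eps * (1 + slack) + C * (105 / (p * N * (1 - p))).
Proof.
move=> df f'B mod_f' phiE C0 eps0 eta0.
have B0 : 0 <= B by exact: le_trans (f'B 0).
pose S e u := f' (Z e u) - Z e u * f (Z e u).
have -> : rade (fun e => bern p (fun u => phi (Z e u))) - c =
    rade (fun e => bern p (fun u => phi (Z e u) - c - S e u)) +
    rade (fun e => bern p (S e)).
  rewrite -bernD -[c in LHS](@bern_cst R I 2^-1) -bernB; apply: eq_bern => e.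
  by rewrite !bernB bern_cst subrK.
apply: le_trans (ler_normD _ _) _; rewrite -!addrA; apply: lerD.
  apply: le_trans (ler_norm_bern _ half01) _.
  apply: (@le_trans _ _ (rade (fun e => bern p (fun u => eta * (1 + Z e u ^+ 2))))).
    apply: bern_le half01 _ => e; apply: le_trans (ler_norm_bern _ p01w) _.
    by apply: bern_le p01w _ => u; exact: phiE.
  under eq_bern => e do rewrite bernZ bernD bern_cst.
  rewrite bernZ bernD bern_cst; apply: ler_wpM2l => //.
  by have := sketch_second_moment; lra.
apply: le_trans (ler_norm_bern _ half01) _.
apply: (@le_trans _ _ (rade (fun e => B * `|1 - V e| + eps * V e +
    C * (p * (1 - p) * \sum_i (kappa * w i e) ^+ 4)))).
  by apply: bern_le half01 _ => e; exact: stein_bern.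
rewrite !bernD !bernZ -addrA.
apply: lerD; first by apply: ler_wpM2l => //; exact: rade_variance_dev.
apply: lerD; apply: ler_wpM2l => //.
  by have := rade_variance; rewrite /V bernZ.
by have := rade_fourth_power; rewrite bernZ.
Qed.

End sketch_normal_approximation.

(** * The central limit theorem *)

Section sketch_statistics.
Context {R : realType}.

Lemma measurable_sketched_dotv d (T : measurableType d) (P : probability T R)
    l m (B D : 'I_(2 ^ l) -> {RV P >-> R}) (u v : 'cV[R]_(2 ^ l)) :
  measurable_fun setT (fun w =>
    sketched_dotv (srht m (fun i => B i w) (fun i => D i w)) u v).
Proof.
under eq_fun do rewrite sketched_dotvE.
apply: measurable_funM => //; apply: measurable_sum => i.
apply: measurable_funM; first exact: measurable_funX.
by apply: measurable_funM; apply: measurable_sum => j; apply: measurable_funM => //;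
   exact: measurable_funM.
Qed.

(** Parseval removes the centering: [dotv u v] is the average over [i] of the
    products of coordinates, so only [b i - m / n] remains. *)
Lemma standardized_sketchE l m (u v : 'cV[R]_(2 ^ l)) (K : R)
    (b e : {ffun 'I_(2 ^ l) -> bool}) : (0 < m)%N ->
  K * (sketched_dotv (srht m (fun i => (b i)%:R) (fun i => bool_sign (e i))) u v
       - dotv u v) =
  centered_sum (m%:R / (2 ^ l)%:R) (fun i => K / m%:R *
    (sketch_coord (@walsh R l) (u ^~ 0) i e * sketch_coord (@walsh R l) (v ^~ 0) i e)) b.
Proof.
move=> m0; have mR : m%:R != 0 :> R by rewrite pnatr_eq0 -lt0n.
have nR : (2 ^ l)%:R != 0 :> R by rewrite pnatr_eq0 expn_eq0.
have := sum_sketch_coordM (u ^~ 0) (v ^~ 0) (@walsh_col R l) e.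
rewrite card_ord -dotvE => /(congr1 (fun x => (2 ^ l)%:R^-1 * x)); rewrite mulKf // => <-.
rewrite sketched_dotvE /centered_sum.
rewrite [RHS](eq_bigr (fun i => K * (m%:R^-1 * (((b i)%:R ^+ 2) *
  (sketch_coord (@walsh R l) (u ^~ 0) i e * sketch_coord (@walsh R l) (v ^~ 0) i e)) -
  (2 ^ l)%:R^-1 * (sketch_coord (@walsh R l) (u ^~ 0) i e *
                   sketch_coord (@walsh R l) (v ^~ 0) i e)))); last first.
  by move=> i _; case: (b i) => /=; field; rewrite mR nR.
by rewrite -mulr_sumr sumrB -!mulr_sumr.
Qed.

End sketch_statistics.

Section regime.
Context {R : realType} (m : nat -> nat).
Hypothesis m_regime : sketch_regime R m.

(** For [l > 0] the logarithm of [2 ^ l] is at least that of [2], so [m l] is at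
    least [ln 2 ^ 2] times its ratio to the squared logarithm. *)
Lemma sample_size_unbounded (K : R) : \forall l \near \oo, K <= (m l)%:R.
Proof.
have [_ /cvgryPge mln _] := m_regime.
have ln2 : 0 < ln (2 : R) by rewrite ln_gt0 // ltr1n.
have := mln (`|K| / ln 2 ^+ 2); apply: filter_app; near=> l => Kl.
have l0 : (0 < l)%N by near: l; exact: nbhs_infty_gt.
have lnl : ln (2 : R) <= ln (2 ^ l)%:R.
  by rewrite ler_ln ?posrE ?ltr0n ?expn_gt0 // ler_nat -[leqLHS]expn1 leq_pexp2l.
have lnl0 : 0 < ln (2 ^ l)%:R :> R by exact: lt_le_trans lnl.
move: Kl; rewrite ler_pdivlMr ?exprn_gt0 // => Kl.
apply: le_trans (ler_norm K) _; apply: le_trans Kl.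
rewrite -mulrA ler_peMr // mulrC ler_pdivlMr ?exprn_gt0 // mul1r.
by rewrite lerXn2r // nnegrE ltW.
Unshelve. all: by end_near. Qed.

Lemma sampling_rate_gap : exists2 r : R, 0 < r &
  \forall l \near \oo, r <= 1 - (m l)%:R / (2 ^ l)%:R.
Proof.
have [_ _ /ereal_inf_lt[_ [V Voo <-] supV]] := m_regime.
pose rate l : \bar R := ((m l)%:R / (2 ^ l)%:R : R)%:E.
case: (ereal_sup _) supV (@ereal_sup_ubound _ (rate @` V))
  => [s s1 Vs|//|_ Vs].
  exists (1 - s); first by rewrite subr_gt0 -lte_fin.
  apply: filterS Voo => l Vl; rewrite lerD2l lerN2 -lee_fin.
  by apply: Vs; exists l.
exists 1 => //; apply: filterS Voo => l Vl.
by have := Vs _ (ex_intro2 _ _ l Vl erefl); rewrite leeNy_eq.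
Qed.

End regime.

Lemma condP_flat {R : realType} (a a' : forall l, 'cV[R]_(2 ^ l)) (delta : R) :
  condP a a' -> 0 < delta ->
  \forall l \near \oo,
    (forall j, `|a l j 0| <= delta) \/ (forall j, `|a' l j 0| <= delta).
Proof.
move=> [] /cvgr0_norm_le /[apply]; apply: filterS => l le_delta; [left|right] => j;
by apply: le_trans (entry_le_normoo _ j) (le_trans (ler_norm _) le_delta).
Qed.

Section sketch_clt.
Context {R : realType}.

(** The test function, hence [bound], depends on [tau] only; then come the
    flatness [delta], the constant [C] of the modulus of [f'], and last the size
    of [m].  Each of the four terms of [sketch_normal_distance] is made at most
    [tau / 4]. *)
Lemma sketch_clt (m : nat -> nat) (a a' : forall l : nat, 'cV[R]_(2 ^ l))
     (d : nat -> measure_display) (T : forall l : nat, measurableType (d l))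
     (P : forall l : nat, probability (T l) R)
     (B D : forall l : nat, 'I_(2 ^ l) -> {RV (P l) >-> R}) :
     (forall l : nat, srht_entries (m l) (B l) (D l)) ->
     (forall l : nat, norm2 (a l) = 1) ->
     (forall l : nat, norm2 (a' l) = 1) ->
     condP a a' ->
     sketch_regime R m ->
     cvg_in_law P
       (fun (l : nat) (w : T l) =>
          Num.sqrt ((m l)%:R / (1 - (m l)%:R / (2 ^ l)%:R)) *
          Num.sqrt (1 / (1 + 2 * dotv (a l) (a' l) ^+ 2)) *
          (sketched_dotv (srht (m l) (fun i => B l i w) (fun i => D l i w))
             (a l) (a' l) - dotv (a l) (a' l)))
       (normal_prob 0 1).
Proof.
move=> entries a1 a'1 flat regime phi phi_cont [M phiM].
rewrite (integral_normal_prob phi_cont phiM); set c := Rintegral _ _ _.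
pose K l : R := Num.sqrt ((m l)%:R / (1 - (m l)%:R / (2 ^ l)%:R)) *
   Num.sqrt (1 / (1 + 2 * dotv (a l) (a' l) ^+ 2)).
pose mean l : R := bern 2^-1 (fun e : {ffun 'I_(2 ^ l) -> bool} =>
  bern ((m l)%:R / (2 ^ l)%:R) (fun b : {ffun 'I_(2 ^ l) -> bool} =>
    phi (K l * (sketched_dotv (srht (m l) (fun i => (b i)%:R) (fun i => bool_sign (e i)))
                  (a l) (a' l) - dotv (a l) (a' l))))).
apply: (@cvg_trans _ ((EFin \o mean) @ \oo)).
  apply: near_eq_cvg; near=> l => /=.
  rewrite (expectation_srht (F := fun b e => phi (K l * (sketched_dotv (srht (m l) b e)
    (a l) (a' l) - dotv (a l) (a' l)))) (entries l)) //.
  apply: measurableT_comp; first exact: continuous_measurable_fun.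
  apply: measurable_funM => //; apply: measurable_funB => //.
  exact: measurable_sketched_dotv.
apply: cvg_EFin; first by near=> l.
apply/cvgrPdist_le => tau tau0.
have [f [f' [bound [df f'b mod_f' phiE]]]] :=
  stein_test_function phi_cont phiM (divr_gt0 tau0 (ltr0n R 80)).
have [C C0 modC] := mod_f' _ (divr_gt0 tau0 (ltr0n R 76)).
have b0 : 0 <= bound by exact: le_trans (f'b 0).
pose delta : R := Num.min 1 (tau / (72 * (bound + 1))).
have delta0 : 0 < delta.
  by rewrite lt_min ltr01 divr_gt0 //; lra.
have [r r0 gap] := sampling_rate_gap regime.
near=> l.
have m0 : (0 < m l)%N.
  rewrite -(ltr0n R); apply: lt_le_trans ltr01 _.
  by near: l; exact: sample_size_unbounded.
have mlarge : 420 * C / (r * tau) <= (m l)%:R.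
  by near: l; exact: sample_size_unbounded.
have rl : r <= 1 - (m l)%:R / (2 ^ l)%:R by near: l.
have flat_l : (forall j, `|a l j 0| <= delta) \/ (forall j, `|a' l j 0| <= delta).
  by near: l; exact: condP_flat.
set p : R := (m l)%:R / (2 ^ l)%:R in rl *.
have mR : 0 < (m l)%:R :> R by rewrite ltr0n.
have nR : 0 < (2 ^ l)%:R :> R by rewrite ltr0n expn_gt0.
have p01 : 0 < p < 1 by rewrite divr_gt0 //=; lra.
have kappaE : (K l / (m l)%:R) ^+ 2 = (p * #|'I_(2 ^ l)|%:R * (1 - p) *
    (1 + 2 * (\sum_j a l j 0 * a' l j 0) ^+ 2))^-1.
  rewrite -dotvE card_ord; set rho := dotv _ _.
  have rho0 : 0 < 1 + 2 * rho ^+ 2 by have := sqr_ge0 rho; lra.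
  rewrite /K -/p -/rho !exprMn !sqr_sqrtr ?divr_ge0 ?ltW //; last by lra.
  rewrite /p; field; rewrite !gt_eqF //=.
  by case/andP: p01 => _; rewrite /p ltr_pdivrMr // mul1r subr_gt0.
have := sketch_normal_distance (@walsh_sqr R l) (@walsh_col R l) (@walsh_row R l)
  (norm2_sum (a1 l)) (norm2_sum (a'1 l)) delta0 flat_l p01 kappaE df f'b modC phiE C0.
rewrite distrC /mean -/p.
under eq_bern => e do under eq_bern => b do rewrite -standardized_sketchE //.
move=> /(_ (ltW (divr_gt0 tau0 (ltr0n R 76))) (ltW (divr_gt0 tau0 (ltr0n R 80)))).
move=> dist; apply: le_trans dist _.
have -> : p * #|'I_(2 ^ l)|%:R = (m l)%:R by rewrite card_ord /p divfK // gt_eqF.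
have delta1 : delta <= 1 by rewrite ge_min lexx.
have bdelta : bound * delta <= tau / 72.
  apply: (@le_trans _ _ (bound * (tau / (72 * (bound + 1))))).
    by rewrite ler_wpM2l // ge_min lexx orbT.
  have -> : bound * (tau / (72 * (bound + 1))) = tau / 72 * (bound / (bound + 1)).
    by field; rewrite gt_eqF //; lra.
  rewrite ler_piMr ?divr_ge0 ?ltW //; rewrite ltr_pdivrMr; lra.
have tail : C * (105 / ((m l)%:R * (1 - p))) <= tau / 4.
  rewrite mulrA ler_pdivrMr ?mulr_gt0 //; last by lra.
  move: mlarge; rewrite ler_pdivrMr ?mulr_gt0 // => mlarge.
  have : (m l)%:R * (r * tau) <= (m l)%:R * (1 - p) * tau.
    rewrite -mulrA; apply: ler_wpM2l (ltW mR) _ _ _.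
    exact: ler_wpM2r (ltW tau0) _ _ rl.
  lra.
have delta2 : delta ^+ 2 <= delta by rewrite expr2 ler_piMl // ltW.
have bdelta2 : bound * delta ^+ 2 <= bound * delta by rewrite ler_wpM2l.
have td : tau * delta <= tau by rewrite ler_piMr // ltW.
have td2 : tau * delta ^+ 2 <= tau * delta by rewrite ler_wpM2l // ltW.
lra.
Unshelve. all: by end_near. Qed.

End sketch_clt.

(** * A degenerate sketch *)

Section degenerate_sketch.
Context {R : realType}.

Lemma gauss_mean_gt0 (g : R -> R) (M u : R) :
  continuous g -> (forall x, `|g x| <= M) -> (forall x, 0 <= g x) ->
  (forall x, u <= x <= u + 1 -> 1 <= g x) ->
  0 < \int[lebesgue_measure]_x (g x * gauss x).
Proof.
move=> cg gM g0 g1.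
pose k : R := gauss (`|u| + 1).
have gauss_k x : u <= x <= u + 1 -> k <= gauss x.
  move=> /andP[ux xu]; rewrite /k !gaussE ler_wpM2l ?normal_peak_ge0 // ler_expR.
  rewrite !mulNr lerN2 ler_wpM2r ?invr_ge0 // -[x ^+ 2]real_normK ?num_real //.
  rewrite lerXn2r ?nnegrE ?addr_ge0 //.
  by have := ler_norm u; have := ler_norm (- u); rewrite normrN ler_norml => ? ?; lra.
have ig := integrable_bounded_gauss measurableT cg gM.
apply: (@lt_le_trans _ _ (\int[lebesgue_measure]_(x in `[u, u + 1]) k)).
  rewrite Rintegral_cst //= lebesgue_measure_itv /= lte_fin ltrDl ltr01 /=.
  by rewrite (addrC u) addrK mulr1 gauss_gt0.
apply: (@le_trans _ _ (\int[lebesgue_measure]_(x in `[u, u + 1]) (g x * gauss x))).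
  apply: le_Rintegral => //.
  - apply: continuous_compact_integrable; first exact: segment_compact.
    by apply: continuous_subspaceT => x; exact: cvg_cst.
  - by apply: integrableS ig.
  - move=> x; rewrite /= in_itv /= => xu.
    by rewrite -[k]mul1r ler_pM ?(ltW (gauss_gt0 _)) ?g1 ?gauss_k.
rewrite /Rintegral fine_le //.
- by apply: integrable_fin_num => //; exact: integrableS ig.
- exact: integrable_fin_num.
- apply: ge0_subset_integral => //; first exact: (measurable_int lebesgue_measure ig).
  by move=> x _; rewrite lee_fin mulr_ge0 // ltW // gauss_gt0.
Qed.

(** The unit vector along [e_0 + s * e_1].  For [l = 0] there is a single
    coordinate. *)
Definition pair_vec (s : R) (l : nat) : 'cV[R]_(2 ^ l) :=
  \col_i (if l == 0%N then 1 else if (i == 0 :> nat)%N then (Num.sqrt 2)^-1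
          else if (i == 1 :> nat)%N then s * (Num.sqrt 2)^-1 else 0).

Lemma pair_vec_sum s l (i0 i1 : 'I_(2 ^ l)) (G : 'I_(2 ^ l) -> R) : (0 < l)%N ->
  i0 = 0%N :> nat -> i1 = 1%N :> nat ->
  \sum_j G j * pair_vec s l j 0 = (Num.sqrt 2)^-1 * (G i0 + s * G i1).
Proof.
move=> l0 i00 i11; have i01 : i1 != i0 by rewrite -val_eqE /= i00 i11.
rewrite (bigD1 i0) //= (bigD1 i1) //= big1 ?addr0; last first.
  move=> j /andP[j0 j1]; rewrite mxE (gtn_eqF l0).
  have -> : (j == 0 :> nat)%N = false by rewrite -(negbTE j0) -val_eqE /= i00.
  have -> : (j == 1 :> nat)%N = false by rewrite -(negbTE j1) -val_eqE /= i11.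
  by rewrite mulr0.
by rewrite !mxE (gtn_eqF l0) i00 i11 /=; ring.
Qed.

Lemma pair_indices l : (0 < l)%N ->
  exists i0 i1 : 'I_(2 ^ l), i0 = 0%N :> nat /\ i1 = 1%N :> nat.
Proof.
move=> l0; have l1 : (1 < 2 ^ l)%N by rewrite -[1%N](expn0 2) ltn_exp2l.
by exists (Ordinal (ltnW l1)), (Ordinal l1).
Qed.

Lemma pair_vec_entry s l (i0 : 'I_(2 ^ l)) : (0 < l)%N -> i0 = 0%N :> nat ->
  pair_vec s l i0 0 = (Num.sqrt 2)^-1.
Proof. by move=> l0 i00; rewrite mxE (gtn_eqF l0) i00. Qed.

Lemma pair_vec_unit s l : s ^+ 2 = 1 -> norm2 (pair_vec s l) = 1.
Proof.
move=> s1; rewrite /norm2 -[RHS]sqrtr1; congr Num.sqrt.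
have [->|l0] := posnP l; first by rewrite big_ord1 mxE expr1n.
have [i0 [i1 [i00 i11]]] := pair_indices l0.
under eq_bigr => j _ do rewrite expr2.
rewrite (pair_vec_sum s (fun j => pair_vec s l j 0) l0 i00 i11) pair_vec_entry //.
rewrite mxE (gtn_eqF l0) i11 /=.
transitivity ((Num.sqrt 2)^-1 ^+ 2 * (1 + s ^+ 2)); first by ring.
by rewrite s1 exprVn sqr_sqrtr // mulVf // pnatr_eq0.
Qed.

Lemma pair_vec_not_flat s : ~ (normoo (pair_vec s l) @[l --> \oo] --> (0 : R)).
Proof.
move=> /cvgr0_norm_lt /(_ (Num.sqrt 2)^-1); rewrite invr_gt0 sqrtr_gt0 ltr0n.
move=> /(_ isT) small; have : \forall l \near \oo, False.
  near=> l.
  have l0 : (0 < l)%N by near: l; exact: nbhs_infty_gt.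
  have [i0 [_ [i00 _]]] := pair_indices l0.
  have : `|normoo (pair_vec s l)| < (Num.sqrt 2)^-1 by near: l.
  apply/negP; rewrite -leNgt; apply: le_trans (ler_norm _).
  apply: le_trans (entry_le_normoo _ i0); rewrite pair_vec_entry //.
  exact: ler_norm.
by case=> N _ /(_ N (leqnn N)).
Unshelve. all: by end_near. Qed.

(** Every product of coordinates is
    [(e i0 ^ 2 * h i i0 ^ 2 - e i1 ^ 2 * h i i1 ^ 2) / 2 = 0]. *)
Lemma sketched_pair_vec l m (b e : {ffun 'I_(2 ^ l) -> bool}) : (0 < l)%N ->
  sketched_dotv (srht m (fun i => (b i)%:R) (fun i => bool_sign (e i)))
    (pair_vec 1 l) (pair_vec (-1) l) = 0.
Proof.
move=> l0; have [i0 [i1 [i00 i11]]] := pair_indices l0.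
rewrite sketched_dotvE big1 ?mulr0 // => i _.
have coord s : \sum_j bool_sign (e j) * (walsh i j * pair_vec s l j 0) =
    (Num.sqrt 2)^-1 *
    (bool_sign (e i0) * walsh i i0 + s * (bool_sign (e i1) * walsh i i1)).
  under eq_bigr => j _ do rewrite mulrA.
  exact: (pair_vec_sum s (fun j => bool_sign (e j) * walsh i j)).
rewrite !coord; set x := bool_sign (e i0) * _; set y := bool_sign (e i1) * _.
have unit_sqr (c : bool) k : (bool_sign c * @walsh R l i k) ^+ 2 = 1.
  by rewrite exprMn bool_sign_sqr walsh_sqr mulr1.
have xy : x ^+ 2 = y ^+ 2 by rewrite !unit_sqr.
transitivity ((b i)%:R ^+ 2 * (Num.sqrt 2)^-1 ^+ 2 * (x ^+ 2 - y ^+ 2)); first by ring.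
by rewrite xy subrr mulr0.
Qed.

Definition half_size (l : nat) : nat := (2 ^ l)./2.

Lemma half_size_rate l : (0 < l)%N -> (half_size l)%:R / (2 ^ l)%:R = 2^-1 :> R.
Proof.
case: l => // l _; rewrite /half_size expnS mul2n doubleK -mul2n natrM.
by rewrite invfM mulrCA divff ?mulr1 // pnatr_eq0 expn_eq0.
Qed.

Lemma half_size_rate_cvg :
  ((half_size l)%:R / (2 ^ l)%:R : R) @[l --> \oo] --> (2^-1 : R).
Proof.
apply: cvg_near_cst; near=> l; rewrite half_size_rate //.
by near: l; exact: nbhs_infty_gt.
Unshelve. all: by end_near. Qed.

(** Makes [2 ^ l / l ^ 2] unbounded; [10] is the first exponent at which the
    inequality starts to hold for good. *)
Lemma cube_le_exp2 k : ((k + 10) ^ 3 <= 2 ^ (k + 10))%N.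
Proof.
elim: k => // k IHk; rewrite addSn [in leqRHS]expnS.
apply: leq_trans (leq_mul (leqnn 2) IHk).
have : (10 <= k + 10)%N by rewrite leq_addl.
move: (k + 10)%N => j j10; rewrite !expnS !expn0 !muln1; nia.
Qed.

Lemma half_size_regime : sketch_regime R half_size.
Proof.
split.
- move=> l; rewrite /half_size; case: l => // l.
  by rewrite expnS mul2n doubleK -addnn -[ltnLHS]addn0 ltn_add2l expn_gt0.
- apply/cvgryPge => K; near=> l.
  have l10 : (10 <= l)%N by near: l; exact: nbhs_infty_ge.
  have lK : 2 * K <= l%:R by near: l; exact: nbhs_infty_ger.
  have l0 : 0 < l%:R :> R by rewrite ltr0n (leq_trans _ l10).
  have ln2 : 0 < ln (2 : R) <= 1.
    rewrite ln_gt0 ?ltr1n //=.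
    have := @le_ln1Dx R 1; rewrite -[1 + 1]/(2 : R); apply; lra.
  have lnE : ln (2 ^ l)%:R = l%:R * ln 2 :> R.
    by rewrite natrX lnXn ?ltr0n // mulr_natl.
  have half : 2 * (half_size l)%:R = (2 ^ l)%:R :> R.
    case: (l) l10 => // k _; rewrite /half_size expnS mul2n doubleK -mul2n natrM.
    by [].
  have cube : l%:R ^+ 3 <= (2 ^ l)%:R :> R.
    by rewrite -natrX ler_nat -(subnK l10) cube_le_exp2.
  have lnl : 0 < ln ((2 ^ l)%:R : R) ^+ 2 <= l%:R ^+ 2.
    case/andP: ln2 => ln20 ln21; rewrite lnE exprn_gt0 ?mulr_gt0 //=.
    apply: lerXn2r; rewrite ?nnegrE ?(ltW l0) ?(ltW (mulr_gt0 l0 ln20)) //.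
    by rewrite ger_pMr.
  case/andP: lnl => lnl0 lnl; rewrite ler_pdivlMr //.
  apply: (@le_trans _ _ (l%:R / 2 * l%:R ^+ 2)).
    apply: (@le_trans _ _ (l%:R / 2 * ln (2 ^ l)%:R ^+ 2)).
      by rewrite ler_wpM2r ?(ltW lnl0) //; lra.
    by rewrite ler_wpM2l // divr_ge0 ?(ltW l0).
  have -> : l%:R / 2 * l%:R ^+ 2 = l%:R ^+ 3 / 2 :> R by ring.
  lra.
- rewrite is_cvg_limn_esupE; last first.
    apply/cvg_ex; exists (2^-1)%:E.
    by apply: cvg_EFin; [near=> l | exact: half_size_rate_cvg].
  rewrite (cvg_lim _ (_ : _ --> (2^-1)%:E)) //.
    by rewrite lte_fin invf_lt1 // ltr1n.
  by apply: cvg_EFin; [near=> l | exact: half_size_rate_cvg].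
Unshelve. all: by end_near. Qed.

(** The law of the sketch is a point mass, at some point [q l] after any affine
    normalization, and a convergent sequence of point masses cannot charge both
    half-lines in the limit. *)
Lemma degenerate_sketch_not_normal (d : nat -> measure_display)
    (T : forall l : nat, measurableType (d l)) (P : forall l : nat, probability (T l) R)
    (B D : forall l : nat, 'I_(2 ^ l) -> {RV (P l) >-> R}) (mu s : nat -> R) :
  (forall l : nat, srht_entries (half_size l) (B l) (D l)) ->
  ~ cvg_in_law P
      (fun (l : nat) (w : T l) => (s l)^-1 *
        (Num.sqrt (half_size l)%:R *
           sketched_dotv (srht (half_size l) (fun i => B l i w) (fun i => D l i w))
             (pair_vec 1 l) (pair_vec (-1) l) - mu l))
      (normal_prob 0 1).
Proof.
move=> entries normal.
pose q l : R := (s l)^-1 * - mu l.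
have point_mass (g : R -> R) (M u : R) : continuous g -> (forall x, `|g x| <= M) ->
    (forall x, 0 <= g x) -> (forall x, u <= x <= u + 1 -> 1 <= g x) ->
    \forall l \near \oo, 0 < g (q l).
  move=> cg gM g0 g1; have := normal g cg (ex_intro _ M gM).
  rewrite (integral_normal_prob cg gM) => /fine_cvg /= gq.
  have mean0 := gauss_mean_gt0 cg gM g0 g1.
  apply: filterS2 (cvgr_gt _ gq _ mean0) (nbhs_infty_gt 0%N) => l + l0; rewrite /=.
  rewrite (expectation_srht (F := fun b e => g ((s l)^-1 *
    (Num.sqrt (half_size l)%:R * sketched_dotv (srht (half_size l) b e)
       (pair_vec 1 l) (pair_vec (-1) l) - mu l))) (entries l)) /=; last first.
    apply: measurableT_comp; first exact: continuous_measurable_fun.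
    apply: measurable_funM => //; apply: measurable_funB => //.
    by apply: measurable_funM => //; exact: measurable_sketched_dotv.
  under eq_bern => e do under eq_bern => b do rewrite sketched_pair_vec // mulr0 sub0r.
  by under eq_bern => e do rewrite bern_cst; rewrite bern_cst.
pose ramp (x : R) : R := Num.min 1 (Num.max 0 x).
have cramp : continuous ramp.
  move=> x; apply: (@continuous_min _ _ (cst 1) (fun x : R => Num.max 0 x)).
    exact: cst_continuous.
  by apply: (@continuous_max _ _ (cst 0) id); [exact: cst_continuous | exact: cvg_id].
have ramp0 x : 0 <= ramp x by rewrite le_min ler01 le_max lexx.
have ramp1 x : `|ramp x| <= 1 by rewrite ger0_norm // ge_min lexx.
have ramp_ge1 x : 1 <= x -> 1 <= ramp x by move=> x1; rewrite le_min lexx le_max x1 orbT.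
have ramp_gt0 x : 0 < ramp x -> 0 < x by rewrite lt_min ltr01 lt_max ltxx.
have pos : \forall l \near \oo, 0 < ramp (q l).
  by apply: (point_mass ramp 1 1) => // x /andP[x1 _]; exact: ramp_ge1.
have neg : \forall l \near \oo, 0 < ramp (- q l).
  apply: (point_mass (ramp \o -%R) 1 (-2)).
  - move=> x; apply: continuous_comp; first by apply: cvgN; exact: cvg_id.
    exact: cramp.
  - by move=> x; exact: ramp1.
  - by move=> x; exact: ramp0.
  - by move=> x /andP[_ x1] /=; apply: ramp_ge1; lra.
have [l [/ramp_gt0 ql /ramp_gt0 nql]] := filter_ex (filterI pos neg).
by move: nql; rewrite oppr_gt0 ltNge (ltW ql).
Unshelve. all: by end_near. Qed.

End degenerate_sketch.

Unset Implicit Arguments.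

(** * The main theorem *)

Theorem mainTheorem9 (R : realType) :
  (forall (m : nat -> nat) (a a' : forall l : nat, 'cV[R]_(2 ^ l))
     (d : nat -> measure_display) (T : forall l : nat, measurableType (d l))
     (P : forall l : nat, probability (T l) R)
     (B D : forall l : nat, 'I_(2 ^ l) -> {RV (P l) >-> R}),
     (forall l : nat, srht_entries (m l) (B l) (D l)) ->
     (forall l : nat, norm2 (a l) = 1) ->
     (forall l : nat, norm2 (a' l) = 1) ->
     condP a a' ->
     sketch_regime R m ->
     cvg_in_law P
       (fun (l : nat) (w : T l) =>
          Num.sqrt ((m l)%:R / (1 - (m l)%:R / (2 ^ l)%:R)) *
          Num.sqrt (1 / (1 + 2 * dotv (a l) (a' l) ^+ 2)) *
          (sketched_dotv (srht (m l) (fun i => B l i w) (fun i => D l i w))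
             (a l) (a' l) - dotv (a l) (a' l)))
       (normal_prob 0 1))
  /\
  (exists (m : nat -> nat) (a a' : forall l : nat, 'cV[R]_(2 ^ l)),
     [/\ (forall l : nat, norm2 (a l) = 1) /\
           (forall l : nat, norm2 (a' l) = 1),
         ~ condP a a',
         sketch_regime R m,
         cvg (((m l)%:R / (2 ^ l)%:R : R) @[l --> \oo]) &
         forall (d : nat -> measure_display)
           (T : forall l : nat, measurableType (d l))
           (P : forall l : nat, probability (T l) R)
           (B D : forall l : nat, 'I_(2 ^ l) -> {RV (P l) >-> R}),
           (forall l : nat, srht_entries (m l) (B l) (D l)) ->
           ~ exists mu s : nat -> R,
               (forall l : nat, 0 < s l) /\
               cvg_in_law P
                 (fun (l : nat) (w : T l) =>
                    (s l)^-1 *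
                    (Num.sqrt (m l)%:R *
                     sketched_dotv
                       (srht (m l) (fun i => B l i w) (fun i => D l i w))
                       (a l) (a' l) - mu l))
                 (normal_prob 0 1)]).
Proof.
split; first exact: sketch_clt.
exists half_size, (pair_vec 1), (pair_vec (-1)); split.
- by split=> l; apply: pair_vec_unit; rewrite ?sqrrN expr1n.
- by case=> /pair_vec_not_flat.
- exact: half_size_regime.
- exact: cvgP half_size_rate_cvg.
- move=> d T P B D entries [mu [s [_ normal]]].
  exact: degenerate_sketch_not_normal entries normal.
Qed.
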